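(* For any $\beta,\varepsilon>0$, $$\Lambda_{\beta_\varepsilon}\Lambda^*_{\beta_\varepsilon}=F_{\beta_\varepsilon}(-L_{\beta+\varepsilon})$$ where, for all $u\in\mathbb R_+$, $$F_{\beta_\varepsilon}(u)=\int_0^\infty e^{-us}\,\mathbb P(\tau^{(\beta_\varepsilon)}\in ds)=\frac{\Gamma(\beta+\varepsilon)\Gamma(u+\varepsilon)}{\Gamma(\varepsilon)\Gamma(u+\beta+\varepsilon)}$$ and $\tau^{(\beta_\varepsilon)}$ is the non-negative random variable with law $$\mathbb P(\tau^{(\beta_\varepsilon)}\in ds)=\frac{\Gamma(\beta+\varepsilon)}{\Gamma(\beta)\Gamma(\varepsilon)}\exp(-\varepsilon s)(1-\exp(-s))^{\beta-1}\,ds,\qquad s\ge0.$$ Similarly, for any $\beta,\varepsilon>0$, $$\Lambda^*_{\beta_\varepsilon}\Lambda_{\beta_\varepsilon}=F_{\beta_\varepsilon}(-L_\varepsilon).$$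
   Context: For $\gamma>0$, $\nu_\gamma(dx)=\frac{x^{\gamma-1}e^{-x}}{\Gamma(\gamma)}dx$ is the gamma distribution on $(0,\infty)$, and $L_\gamma$ is the Laguerre operator $L_\gamma[f](x)=xf''(x)+(\gamma-x)f'(x)$, extended to a self-adjoint operator on $\mathbf L^2(\nu_\gamma)$. The spectrum of $-L_\gamma$ is $\mathbb Z_+$ with simple eigenvalues, the eigenfunctions being the Laguerre polynomials; $F(-L_\gamma)$ is defined by functional calculus. For $\beta,\varepsilon>0$, $\Lambda_{\beta_\varepsilon}$ is the Markov kernel from $\mathbb R_+$ to $\mathbb R_+$ given on bounded measurable $f$ by $$\Lambda_{\beta_\varepsilon}[f](x)=\frac{\Gamma(\beta+\varepsilon)}{\Gamma(\beta)\Gamma(\varepsilon)}\int_0^1f(rx)\,r^{\varepsilon-1}(1-r)^{\beta-1}\,dr,$$ viewed as an operator $\mathbf L^2(\nu_\varepsilon)\to\mathbf L^2(\nu_{\beta+\varepsilon})$, and $\Lambda_{\beta_\varepsilon}^*:\mathbf L^2(\nu_{\beta+\varepsilon})\to\mathbf L^2(\nu_\varepsilon)$ is its adjoint. *)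

(* Defs.v *)
From HB Require Import structures.
From mathcomp Require Import all_boot all_order all_algebra.
From mathcomp Require Import all_classical all_reals all_analysis.
From mathcomp Require Import measurable_realfun.

Set Implicit Arguments.
Unset Strict Implicit.
Unset Printing Implicit Defensive.

Import Order.TTheory GRing.Theory Num.Theory.
Import numFieldNormedType.Exports.

Local Open Scope classical_set_scope.
Local Open Scope ring_scope.

(** Elements of L^2(mu) are represented by functions in [Lfun mu 2]; two of them
    denote the same element when they are mu-a.e. equal. Scalars are real. *)
Section L2.
Context d (T : measurableType d) (R : realType).
Implicit Types mu : {measure set T -> \bar R}.

Definition L2dot mu (f g : T -> R) : R := \int[mu]_x (f x * g x).

(** The limit is determined only up to mu-a.e. equality. *)
Definition L2cvg mu (u : nat -> T -> R) (f : T -> R) : Prop :=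
  ('N[mu]_2%:E[EFin \o (u n \- f)%R])%E @[n --> \oo] --> 0%E.

(** An unbounded operator on L^2(mu) is given by its graph:
    [A f g] reads "f is in the domain of A and A f = g". *)
Definition L2_graph := (T -> R) -> (T -> R) -> Prop.

Definition opp_graph (A : L2_graph) : L2_graph := fun f g => A f (\- g).

Definition L2_series mu (a : nat -> R) (e : nat -> T -> R) (f : T -> R)
    (N : nat) : T -> R :=
  fun x => \sum_(n < N) a n * L2dot mu f (e n) * e n x.

(** (e_n) is an orthonormal basis of L^2(mu), and A is the self-adjoint operator
    sum_n lam_n <., e_n> e_n with its maximal domain
    { f | sum_n lam_n^2 <f, e_n>^2 < oo }. *)
Definition diagonalizes mu (A : L2_graph) (lam : nat -> R) (e : nat -> T -> R) :=
  [/\ forall n, e n \in Lfun mu 2%:E,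
      forall m n, L2dot mu (e m) (e n) = (m == n)%:R,
      forall f, f \in Lfun mu 2%:E -> L2cvg mu (L2_series mu (fun=> 1) e f) f
    & forall f g, f \in Lfun mu 2%:E -> g \in Lfun mu 2%:E ->
        (A f g <-> L2cvg mu (L2_series mu lam e f) g)].

(** [is_functional_calculus mu A F S] : A is self-adjoint with pure point
    spectrum, F(A) is everywhere defined, and F(A) = S, where
    F(A) = sum_n F(lam_n) <., e_n> e_n by the spectral theorem; this operator does
    not depend on the diagonalization (lam, e) of A, and it involves only the
    values of F on the spectrum of A. *)
Definition is_functional_calculus mu (A : L2_graph) (F : R -> R)
    (S : (T -> R) -> T -> R) : Prop :=
  exists lam e, diagonalizes mu A lam e /\
    forall f, f \in Lfun mu 2%:E ->
      S f \in Lfun mu 2%:E /\ L2cvg mu (L2_series mu (F \o lam) e f) (S f).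

End L2.

(** The Hilbert space adjoint of Q : L^2(mu) -> L^2(nu): [L2adjoint mu nu Q g] is
    the (mu-a.e. unique) h in L^2(mu) with <Q f, g>_nu = <f, h>_mu for all f. *)
Definition L2adjoint d1 d2 (T1 : measurableType d1) (T2 : measurableType d2)
    (R : realType) (mu : {measure set T1 -> \bar R})
    (nu : {measure set T2 -> \bar R}) (Q : (T1 -> R) -> T2 -> R)
    (g : T2 -> R) : T1 -> R :=
  xget (cst 0) [set h | h \in Lfun mu 2%:E /\
    forall f, f \in Lfun mu 2%:E -> L2dot nu (Q f) g = L2dot mu f h].

Section laguerre.
Context {R : realType}.
Local Notation leb := (@lebesgue_measure R).

Definition Gamma (a : R) : R :=
  \int[leb]_(x in `]0, +oo[) (x `^ (a - 1) * expR (- x)).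

Lemma Gamma_ge0 a : 0 <= Gamma a.
Proof. by apply: Rintegral_ge0 => x _; rewrite mulr_ge0 ?powR_ge0 ?expR_ge0. Qed.

Definition gamma_pdf (gam : R) : R -> R :=
  (fun x => x `^ (gam - 1) * expR (- x) / Gamma gam) \_ `]0, +oo[.

Definition beta_cst (beta eps : R) : R :=
  Gamma (beta + eps) / (Gamma beta * Gamma eps).

Definition tau_pdf (beta eps : R) : R -> R :=
  (fun s => beta_cst beta eps * (expR (- (eps * s)) *
     (1 - expR (- s)) `^ (beta - 1))) \_ `[0, +oo[.

Lemma gamma_pdf_ge0 gam x : 0 <= gamma_pdf gam x.
Proof.
apply: restrict_ge0 => {}x _.
by rewrite divr_ge0 ?Gamma_ge0// mulr_ge0 ?powR_ge0 ?expR_ge0.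
Qed.

Lemma measurable_gamma_pdf gam : measurable_fun setT (gamma_pdf gam).
Proof.
apply/measurable_restrict => //; apply: measurable_funTS.
apply: measurable_funM => //; apply: measurable_funM.
  exact: measurable_powR.
by apply: measurableT_comp => //; exact: measurable_expR.
Qed.

Lemma tau_pdf_ge0 beta eps x : 0 <= tau_pdf beta eps x.
Proof.
apply: restrict_ge0 => {}x _.
by rewrite !mulr_ge0 ?invr_ge0 ?mulr_ge0 ?Gamma_ge0 ?powR_ge0 ?expR_ge0.
Qed.

Lemma measurable_tau_pdf beta eps : measurable_fun setT (tau_pdf beta eps).
Proof.
apply/measurable_restrict => //; apply: measurable_funTS.
apply: measurable_funM => //; apply: measurable_funM.
  apply: measurableT_comp; first exact: measurable_expR.
  by apply: measurableT_comp => //; exact: measurable_funM.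
apply: (measurableT_comp (measurable_powR _)).
by apply: measurable_funB => //; exact: measurableT_comp.
Qed.

Definition density (p : R -> R) :=
  fun V => (\int[leb]_(x in V) (p x)%:E)%E.

Section density_measure.
Variables (p : R -> R) (p_ge0 : forall x, 0 <= p x)
  (mp : measurable_fun setT p).

Lemma density0 : density p set0 = 0%E.
Proof. by rewrite /density integral_set0. Qed.

Lemma density_ge0 V : (0 <= density p V)%E.
Proof. by apply: integral_ge0 => x _; rewrite lee_fin. Qed.

Lemma density_sigma_additive : semi_sigma_additive (density p).
Proof.
apply: semi_sigma_additive_nng_induced => //.
exact/measurable_EFinP.
Qed.

End density_measure.

Definition nu_gamma (gam : R) := density (gamma_pdf gam).

HB.instance Definition _ gam := isMeasure.Build _ _ _ (nu_gamma gam)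
  (density0 (gamma_pdf gam)) (density_ge0 (gamma_pdf_ge0 gam))
  (density_sigma_additive (gamma_pdf_ge0 gam) (measurable_gamma_pdf gam)).

(** Total mass 1 is the value of the Laplace transform [F_tau] at u = 0. *)
Definition tau_law (beta eps : R) := density (tau_pdf beta eps).

HB.instance Definition _ beta eps := isMeasure.Build _ _ _ (tau_law beta eps)
  (density0 (tau_pdf beta eps)) (density_ge0 (tau_pdf_ge0 beta eps))
  (density_sigma_additive (tau_pdf_ge0 beta eps) (measurable_tau_pdf beta eps)).

Definition F_tau (beta eps u : R) : R :=
  \int[tau_law beta eps]_(s in `[0, +oo[) expR (- (u * s)).

Definition laguerre (gam : R) (f : R -> R) (x : R) : R :=
  x * (f^`(2))%classic x + (gam - x) * (f^`())%classic x.

(** The self-adjoint extension: the closure in L^2(nu_gam) of the differential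
    operator on polynomials, which are a core containing all the eigenfunctions.
    (Test functions with compact support in (0, +oo) would not do: for gam < 2 the
    operator is not essentially self-adjoint on them.) *)
Definition laguerre_op (gam : R) : L2_graph R R := fun f g =>
  [/\ f \in Lfun (nu_gamma gam) 2%:E, g \in Lfun (nu_gamma gam) 2%:E
    & exists p : nat -> {poly R},
        L2cvg (nu_gamma gam) (fun n => horner (p n)) f /\
        L2cvg (nu_gamma gam) (fun n => laguerre gam (horner (p n))) g].

(** For f in L^2(nu_eps) the integral converges for almost every x > 0; on the
    remaining null set [Rintegral] returns a default value. *)
Definition Lambda (beta eps : R) (f : R -> R) (x : R) : R :=
  beta_cst beta eps *
  \int[leb]_(r in `]0, 1[)
    (f (r * x) * r `^ (eps - 1) * (1 - r) `^ (beta - 1)).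

Definition Lambda_adj (beta eps : R) : (R -> R) -> R -> R :=
  L2adjoint (nu_gamma eps) (nu_gamma (beta + eps)) (Lambda beta eps).

End laguerre.

(* Main.v *)
(** If X ~ Gamma(eps) and Y ~ Gamma(beta) are independent, then X + Y ~
    Gamma(beta + eps) is independent of X / (X + Y), which is Beta-distributed;
    so [Lambda f] is E(f(X) | X + Y). It is therefore an L^2 contraction, and its
    adjoint is the other conditional expectation, g |-> E(g(X + Y) | X).
    Since Lambda x^k = (eps)_k / (beta + eps)_k x^k, Lambda maps the Laguerre
    polynomial sum_k (-1)^k C(n, k) x^k / (eps)_k of parameter eps to the one of
    parameter beta + eps. Their squared norms n! / (gam)_n turn this into
    Lambda e_n = c_n e'_n between the orthonormal bases, where
    c_n^2 = (eps)_n / (beta + eps)_n = F(n). By duality Lambda^* e'_n = c_n e_n, so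
    both products are diagonal with eigenvalues F(n).
    Completeness of the polynomials in L^2(nu_gam): the bounded functions w such
    that w q lies in the closure of the polynomials for every polynomial q form
    an algebra, stable under bounded pointwise limits. Taylor expansion puts
    e^(-s x) in it for small s > 0; powers and limits give indicators of rays,
    hence of Borel sets. *)

(* Operator identities are read off from coefficients. The expansion of an element of L^2 in an
   orthonormal basis converges to it, so S = F(A) reduces to two facts: S f lies in L^2, and <S f,
   e_n> = F(n) <f, e_n> for every n. Two obstacles shape the rest. The adjoint is selected by
   [xget], so nothing is known about it until some function with the adjoint property is exhibited;
   integrating g against the joint density of (X, X + Y) and dividing by the density of X provides
   one. Even then it is fixed only up to null sets, so Lambda^* e'_n = c_n e_n is used only in inner
   products. Real integrals take a default value where they diverge, which can happen for [Lambda] f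
   on a null set. The identities defining conditional expectations nevertheless hold at every point,
   because scaling by c > 0 and affine substitution respect the default value. Convergence matters
   only for Fubini applied to f(x) g(z) k(x, z), where |f g| <= f^2 + g^2 gives integrability. *)
Require Import Defs.
From HB Require Import structures.
From mathcomp Require Import all_boot all_order all_algebra.
From mathcomp Require Import all_classical all_reals all_analysis.
From mathcomp Require Import measurable_realfun ring lra.

Set Implicit Arguments.
Unset Strict Implicit.
Unset Printing Implicit Defensive.

Import Order.TTheory GRing.Theory Num.Theory.
Import numFieldNormedType.Exports.

Local Open Scope classical_set_scope.
Local Open Scope ring_scope.

(** * The Hilbert space L^2 *)

Section L2theory.
Context d (T : measurableType d) (R : realType).
Variable mu : {measure set T -> \bar R}.
Implicit Types f g h : T -> R.
Local Notation L2 := (Lfun mu 2%:E).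
Local Notation dot := (L2dot mu).

Lemma abse_poweR2 (x : R) : (`| x%:E | `^ 2)%E = (x ^+ 2)%:E.
Proof. by rewrite abse_EFin poweR_EFin powR_mulrn// real_normK ?num_real. Qed.

Lemma Lfun2P f : f \in L2 <->
  measurable_fun setT f /\ (\int[mu]_x (f x ^+ 2)%:E < +oo)%E.
Proof.
split=> [fL|[mf fL]].
  move: (fL) => /[!inE] /andP[/[!inE]/= mf _]; split=> //.
  have /integrableP[_] := Lfun2_integrable_sqr fL.
  by under eq_integral do rewrite /= ger0_norm ?sqr_ge0//.
rewrite inE; apply/andP; split; rewrite inE//= /finite_norm unlock.
rewrite poweR_lty//.
by rewrite (eq_integral (fun x => (f x ^+ 2)%:E)) => // x _; exact: abse_poweR2.
Qed.

Lemma Lfun2_measurable f : f \in L2 -> measurable_fun setT f.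
Proof. by case/Lfun2P. Qed.

Lemma Lfun2_mul_integrable f g : f \in L2 -> g \in L2 ->
  mu.-integrable setT (EFin \o (fun x => f x * g x)).
Proof. by move=> fL gL; apply/Lfun1_integrable; exact: Lfun2_mul_Lfun1. Qed.

Lemma Lfun2Z a f : f \in L2 -> (fun x => a * f x) \in L2.
Proof.
move=> /Lfun2P[mf fL]; apply/Lfun2P; split; first exact: measurable_funM.
under eq_integral do rewrite exprMn EFinM.
rewrite ge0_integralZl ?lee_fin ?sqr_ge0//.
- by rewrite lte_mul_pinfty ?lee_fin ?sqr_ge0.
- exact/measurable_EFinP/measurable_funX.
- by move=> x _; rewrite lee_fin sqr_ge0.
Qed.

Lemma Lfun2D f g : f \in L2 -> g \in L2 -> (fun x => f x + g x) \in L2.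
Proof.
move=> /Lfun2P[mf fL] /Lfun2P[mg gL]; apply/Lfun2P.
split; first exact: measurable_funD.
apply: (@le_lt_trans _ _ (\int[mu]_x ((2 * f x ^+ 2)%:E + (2 * g x ^+ 2)%:E))%E).
  apply: ge0_le_integral => //.
  - by move=> x _; rewrite lee_fin sqr_ge0.
  - by apply/measurable_EFinP/measurable_funX/measurable_funD.
  - apply/measurable_EFinP; apply: (measurable_funD (f := fun x => 2 * f x ^+ 2)
    (g := fun x => 2 * g x ^+ 2)); apply: measurable_funM => //; exact: measurable_funX.
  - by move=> x _; rewrite -EFinD lee_fin; have := sqr_ge0 (f x - g x); nra.
have mX (k : T -> R) : measurable_fun setT k ->
    measurable_fun setT (fun x => (2 * k x ^+ 2)%:E).
  by move=> mk; apply/measurable_EFinP/measurable_funM => //; exact: measurable_funX.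
rewrite ge0_integralD//; last 4 first.
- by move=> x _; rewrite lee_fin mulr_ge0 ?sqr_ge0.
- exact: mX.
- by move=> x _; rewrite lee_fin mulr_ge0 ?sqr_ge0.
- exact: mX.
have Z (k : T -> R) : measurable_fun setT k -> (\int[mu]_x (k x ^+ 2)%:E < +oo ->
   \int[mu]_x (2 * k x ^+ 2)%:E < +oo)%E.
  move=> mk kL; under eq_integral do rewrite EFinM.
  rewrite ge0_integralZl ?lee_fin ?sqr_ge0//.
  + by rewrite lte_mul_pinfty ?lee_fin ?sqr_ge0.
  + exact/measurable_EFinP/measurable_funX.
  + by move=> x _; rewrite lee_fin sqr_ge0.
by rewrite lte_add_pinfty// Z.
Qed.

Lemma Lfun2N f : f \in L2 -> (fun x => - f x) \in L2.
Proof. by move=> /(Lfun2Z (-1)); congr (_ \in L2); apply/funext=> x; rewrite mulN1r. Qed.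

Lemma Lfun2B f g : f \in L2 -> g \in L2 -> (fun x => f x - g x) \in L2.
Proof. by move=> fL gL; exact: (Lfun2D fL (Lfun2N gL)). Qed.

Lemma Lfun2_0 : (fun=> 0) \in L2.
Proof.
apply/Lfun2P; split => //.
by under eq_integral do rewrite expr0n/=; rewrite integral0.
Qed.

Lemma Lfun2_sum n (F : nat -> T -> R) : (forall i, (i < n)%N -> F i \in L2) ->
  (fun x => \sum_(i < n) F i x) \in L2.
Proof.
elim: n => [|n IH] H.
  by under [X in X \in _]eq_fun do rewrite big_ord0; exact: Lfun2_0.
under [X in X \in _]eq_fun do rewrite big_ord_recr/=.
by apply: Lfun2D; [apply: IH => i ni; apply: H; rewrite ltnW|exact: H].
Qed.

Lemma L2dotC f g : dot f g = dot g f.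
Proof. by apply: eq_Rintegral => x _; rewrite mulrC. Qed.

Lemma L2dotDl f g h : f \in L2 -> g \in L2 -> h \in L2 ->
  dot (fun x => f x + g x) h = dot f h + dot g h.
Proof.
move=> fL gL hL; rewrite /L2dot -RintegralD//; try exact: Lfun2_mul_integrable.
by apply: eq_Rintegral => x _; rewrite mulrDl.
Qed.

Lemma L2dotZl a f h : f \in L2 -> h \in L2 ->
  dot (fun x => a * f x) h = a * dot f h.
Proof.
move=> fL hL; rewrite /L2dot -RintegralZl//; try exact: Lfun2_mul_integrable.
by apply: eq_Rintegral => x _; rewrite mulrA.
Qed.

Lemma L2dotNl f h : f \in L2 -> h \in L2 -> dot (fun x => - f x) h = - dot f h.
Proof.
move=> fL hL; rewrite -mulN1r -L2dotZl//.
by apply: eq_Rintegral => x _; rewrite mulN1r.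
Qed.

Lemma L2dotBl f g h : f \in L2 -> g \in L2 -> h \in L2 ->
  dot (fun x => f x - g x) h = dot f h - dot g h.
Proof. by move=> fL gL hL; rewrite L2dotDl ?L2dotNl//; exact: Lfun2N. Qed.

Lemma L2dot0l h : dot (fun=> 0) h = 0.
Proof.
rewrite /L2dot /Rintegral; under eq_integral do rewrite mul0r.
by rewrite integral0.
Qed.

Lemma L2dot_suml n (F : nat -> T -> R) h : (forall i, F i \in L2) -> h \in L2 ->
  dot (fun x => \sum_(i < n) F i x) h = \sum_(i < n) dot (F i) h.
Proof.
move=> FL hL; elim: n => [|n IH].
  rewrite big_ord0 -[RHS](L2dot0l h).
  by apply: eq_Rintegral => x _; rewrite big_ord0.
rewrite big_ord_recr/= -IH -L2dotDl//; last exact: Lfun2_sum.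
by apply: eq_Rintegral => x _; rewrite big_ord_recr.
Qed.

Lemma L2dot_ge0 f : 0 <= dot f f.
Proof. by apply: Rintegral_ge0 => x _; rewrite -expr2 sqr_ge0. Qed.

Lemma EFin_L2dot f : f \in L2 -> (dot f f)%:E = (\int[mu]_x (f x ^+ 2)%:E)%E.
Proof.
move=> fL; rewrite /L2dot /Rintegral fineK.
  by apply: eq_integral => x _; rewrite expr2.
have /integrable_fin_num := Lfun2_mul_integrable fL fL.
by apply.
Qed.

Lemma L2dot_addsq f g : f \in L2 -> g \in L2 ->
  dot (fun x => f x + g x) (fun x => f x + g x) = dot f f + 2 * dot f g + dot g g.
Proof.
move=> fL gL; have fgL := Lfun2D fL gL.
rewrite L2dotDl// L2dotC (L2dotC g) !L2dotDl// (L2dotC g f); ring.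
Qed.

(** Expanding <f - g, f - g> >= 0 bounds the cross term. This replaces the triangle inequality when
    distances are kept squared. *)
Lemma L2dot_add_le f g : f \in L2 -> g \in L2 ->
  dot (fun x => f x + g x) (fun x => f x + g x) <= 2 * dot f f + 2 * dot g g.
Proof.
move=> fL gL; have := L2dot_ge0 (fun x => f x + - 1 * g x).
rewrite !L2dot_addsq//; last exact: Lfun2Z.
rewrite L2dotZl//; last exact: Lfun2Z.
by rewrite (L2dotC g) (L2dotC f) !L2dotZl// (L2dotC g f); lra.
Qed.

Lemma L2dot_CS f g : f \in L2 -> g \in L2 -> dot f g ^+ 2 <= dot f f * dot g g.
Proof.
move=> fL gL.
have H a : 0 <= a ^+ 2 * dot f f + 2 * a * dot f g + dot g g.
  have := L2dot_ge0 (fun x => a * f x + g x).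
  rewrite L2dot_addsq//; last exact: Lfun2Z.
  rewrite L2dotZl//; last exact: Lfun2Z.
  rewrite (L2dotC f) !L2dotZl//.
  by congr (_ <= _); ring.
have := L2dot_ge0 f; rewrite le_eqVlt => /orP[/eqP f0|f0].
  rewrite -f0 mul0r.
  (* When <f, f> = 0 the quadratic in a is affine; unless <f, g> = 0, this a would give it the value
     -1. *)
  have := H (- ((1 + dot g g) / (2 * dot f g))).
  rewrite -f0 mulr0 add0r.
  have [->|fg0] := eqVneq (dot f g) 0; first by rewrite expr0n.
  have -> : 2 * - ((1 + dot g g) / (2 * dot f g)) * dot f g = - (1 + dot g g).
    by field.
  lra.
(* The minimiser of the quadratic. *)
have := H (- (dot f g / dot f f)).
have -> : (- (dot f g / dot f f)) ^+ 2 * dot f f +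
    2 * - (dot f g / dot f f) * dot f g + dot g g = (dot f f * dot g g - dot f g ^+ 2) / dot f f.
  by field; rewrite gt_eqF.
by rewrite pmulr_lge0 ?invr_gt0// subr_ge0.
Qed.

Lemma Lnorm2E f : f \in L2 ->
  ('N[mu]_2%:E[EFin \o f])%E = (Num.sqrt (dot f f))%:E.
Proof.
move=> fL; rewrite unlock (eq_integral (fun x => (f x ^+ 2)%:E)); last first.
  by move=> x _; exact: abse_poweR2.
by rewrite -EFin_L2dot// poweR_EFin powR12_sqrt// L2dot_ge0.
Qed.

(** Replaces the extended-real norm by the squared distance, to which the algebra of the inner
    product applies directly. *)
Lemma L2cvgP (u : nat -> T -> R) f : (forall n, u n \in L2) -> f \in L2 ->
  L2cvg mu u f <->
  (fun n => dot (fun x => u n x - f x) (fun x => u n x - f x)) @ \oo --> 0.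
Proof.
move=> uL fL; rewrite /L2cvg.
under eq_fun do rewrite Lnorm2E ?Lfun2B//.
set a := fun n => dot (fun x => u n x - f x) (fun x => u n x - f x).
rewrite -[X in X <-> _]/((Num.sqrt (a n))%:E @[n --> \oo] --> 0%E).
have aE : a = fun n => Num.sqrt (a n) * Num.sqrt (a n).
  by apply/funext => n; rewrite -expr2 sqr_sqrtr// L2dot_ge0.
split=> [/fine_cvg/= H|H].
  by rewrite aE -(mulr0 0); apply: cvgM.
apply/fine_cvgP; split; first exact: nearW.
rewrite -[X in _ --> X](sqrtr0 R).
by apply: continuous_cvg => //; exact: sqrt_continuous.
Qed.

Lemma L2cvg_dot (u : nat -> T -> R) f g : (forall n, u n \in L2) -> f \in L2 ->
  g \in L2 -> L2cvg mu u f -> dot (u n) g @[n --> \oo] --> dot f g.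
Proof.
move=> uL fL gL /L2cvgP-/(_ uL fL) H.
have H1 : Num.sqrt (dot (fun x => u n x - f x) (fun x => u n x - f x) * dot g g)
   @[n --> \oo] --> 0.
  rewrite -[X in _ --> X](sqrtr0 R); apply: continuous_cvg.
    exact: sqrt_continuous.
  by rewrite -[X in _ --> X](mul0r (dot g g)); apply: cvgMl.
apply/cvgrPdist_lt => e e0.
move/cvgrPdist_lt: H1 => /(_ _ e0); apply: filterS => n.
rewrite sub0r normrN ger0_norm ?sqrtr_ge0//.
apply: le_lt_trans.
rewrite distrC -L2dotBl// -sqrtr_sqr ler_sqrt; last first.
  by rewrite mulr_ge0// L2dot_ge0.
exact: L2dot_CS (Lfun2B _ _) _.
Qed.

Lemma L2cvgN (u : nat -> T -> R) f : (forall n, u n \in L2) -> f \in L2 ->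
  L2cvg mu u f -> L2cvg mu (fun n x => - u n x) (fun x => - f x).
Proof.
move=> uL fL /(L2cvgP uL fL) H; apply/L2cvgP.
- by move=> n; exact: Lfun2N.
- exact: Lfun2N.
suff -> : (fun n => dot (fun x => - u n x - - f x) (fun x => - u n x - - f x)) =
  (fun n => dot (fun x => u n x - f x) (fun x => u n x - f x)) by exact: H.
by apply/funext => n; apply: eq_Rintegral => x _; ring.
Qed.

Lemma eq_L2cvg (u v : nat -> T -> R) f : (forall n x, u n x = v n x) ->
  L2cvg mu u f -> L2cvg mu v f.
Proof. by move=> uv; have -> : u = v by apply/funext => n; apply/funext. Qed.

Section orthonormal.
Variable e : nat -> T -> R.
Hypotheses (eL : forall n, e n \in L2)
  (ee : forall m n, dot (e m) (e n) = (m == n)%:R).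

Lemma Lfun2_comb (a : nat -> R) N : (fun x => \sum_(n < N) a n * e n x) \in L2.
Proof. by apply: (Lfun2_sum (F := fun n x => a n * e n x)) => i _; exact: Lfun2Z. Qed.

Lemma L2dot_comb (a : nat -> R) N h : h \in L2 ->
  dot (fun x => \sum_(n < N) a n * e n x) h = \sum_(n < N) a n * dot (e n) h.
Proof.
move=> hL; rewrite (L2dot_suml _ (F := fun n x => a n * e n x))//.
  by apply: eq_bigr => i _; rewrite L2dotZl.
by move=> i; exact: Lfun2Z.
Qed.

Lemma L2dot_comb_basis (a : nat -> R) N n : (n < N)%N ->
  dot (fun x => \sum_(n < N) a n * e n x) (e n) = a n.
Proof.
move=> nN; rewrite L2dot_comb// (bigD1 (Ordinal nN))//= ee eqxx mulr1 big1 ?addr0//.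
by move=> i; rewrite -val_eqE/= ee => /negbTE ->; rewrite mulr0.
Qed.

Lemma L2_series_Lfun (a : nat -> R) f N : L2_series mu a e f N \in L2.
Proof. exact: (Lfun2_comb (fun n => a n * dot f (e n))). Qed.

(** Pythagoras: the residual of the partial sum is orthogonal to e_0, ..., e_(N-1), hence to its
    difference with any other combination. *)
Lemma L2_best_approx f (c : nat -> R) N : f \in L2 ->
  dot (fun x => L2_series mu (fun=> 1) e f N x - f x)
      (fun x => L2_series mu (fun=> 1) e f N x - f x) <=
  dot (fun x => f x - \sum_(n < N) c n * e n x)
      (fun x => f x - \sum_(n < N) c n * e n x).
Proof.
move=> fL.
set S := L2_series _ _ _ _ _; have SL : S \in L2 by exact: L2_series_Lfun.
set p := fun x => \sum_(n < N) c n * e n x; have pL : p \in L2 by exact: Lfun2_comb.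
have SfL : (fun x => S x - f x) \in L2 by exact: Lfun2B.
have pSL : (fun x => p x - S x) \in L2 by exact: Lfun2B.
have orth n : (n < N)%N -> dot (e n) (fun x => S x - f x) = 0.
  move=> nN; rewrite L2dotC L2dotBl//.
  by rewrite (L2dot_comb_basis (fun n => 1 * dot f (e n)))// mul1r subrr.
have -> : dot (fun x => f x - p x) (fun x => f x - p x) =
    dot (fun x => (S x - f x) + (p x - S x)) (fun x => (S x - f x) + (p x - S x)).
  by apply: eq_Rintegral => x _; ring.
rewrite (L2dot_addsq SfL pSL).
suff -> : dot (fun x => S x - f x) (fun x => p x - S x) = 0.
  by rewrite mulr0 addr0 lerDl L2dot_ge0.
rewrite L2dotC L2dotBl// (L2dot_comb (fun n => 1 * dot f (e n)))// L2dot_comb//.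
by rewrite !big1 ?subrr// => i _; rewrite orth ?mulr0.
Qed.

(** Any good approximation from the span makes the partial sum of the same length at least as
    good. *)
Lemma L2_basis_series f : f \in L2 ->
  (forall r, 0 < r -> exists N, forall n, (N <= n)%N -> exists c : nat -> R,
     dot (fun x => f x - \sum_(i < n) c i * e i x)
         (fun x => f x - \sum_(i < n) c i * e i x) < r) ->
  L2cvg mu (L2_series mu (fun=> 1) e f) f.
Proof.
move=> fL H; apply/L2cvgP => //; first by move=> n; exact: L2_series_Lfun.
apply/cvgrPdist_lt => r r0; have [N HN] := H _ r0.
exists N => // n /= Nn; have [c hc] := HN _ Nn.
rewrite sub0r normrN ger0_norm ?L2dot_ge0//.
exact: le_lt_trans (L2_best_approx _ _ fL) hc.
Qed.

Hypothesis basis : forall f, f \in L2 -> L2cvg mu (L2_series mu (fun=> 1) e f) f.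

(** Turns a claim about a function of an operator into one scalar identity per n: term by term, the
    series is then the expansion of g itself. *)
Lemma L2_series_coef (a : nat -> R) f g : g \in L2 ->
  (forall n, dot g (e n) = a n * dot f (e n)) -> L2cvg mu (L2_series mu a e f) g.
Proof.
move=> gL H; apply: eq_L2cvg (basis gL) => n x.
by apply: eq_bigr => i _; rewrite mul1r H.
Qed.

(** An h with a single nonzero coefficient acts as c e_k in every inner product, without passing
    through a.e. equality. It is applied to h = Lambda^* e'_k. *)
Lemma L2dot_eigenvector c k f h : f \in L2 -> h \in L2 ->
  (forall m, dot (e m) h = c * (m == k)%:R) -> dot f h = c * dot f (e k).
Proof.
move=> fL hL H.
have := L2cvg_dot (fun n => L2_series_Lfun _ f n) fL hL (basis fL).
move=> /cvg_lim <-//; apply: lim_near_cst => //.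
(* From k + 1 terms on, the partial sum of f contains its k-th term and its product with h is
   constant. *)
exists k.+1 => // n /= kn.
rewrite (L2dot_comb (fun n => 1 * dot f (e n)))//.
under eq_bigr do rewrite H mulrCA.
rewrite -mulr_sumr; congr (_ * _).
rewrite (bigD1 (Ordinal kn))//= eqxx mulr1 mul1r big1 ?addr0//.
by move=> i; rewrite -val_eqE/= => /negbTE ->; rewrite mulr0.
Qed.

End orthonormal.
End L2theory.

(** * Integrals against densities and changes of variables *)

Section density_integral.
Context d (T : measurableType d) (R : realType).
Variables (m mu : {measure set T -> \bar R}) (p : T -> R).
Hypotheses (p_ge0 : forall x, 0 <= p x) (mp : measurable_fun setT p)
  (muE : forall A, measurable A -> mu A = (\int[m]_(x in A) (p x)%:E)%E).

Import HBNNSimple.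

Let nnsfun_integral_density (h : {nnsfun T >-> R}) :
  (\int[mu]_x (h x)%:E = \int[m]_x ((h x)%:E * (p x)%:E))%E.
Proof.
have mh r : measurable (h @^-1` [set r]) by [].
transitivity (\int[mu]_x
   (\sum_(y \in range h) (y * \1_(h @^-1` [set y]) x)%:E))%E.
  by apply: eq_integral => t _; rewrite fimfunE -fsumEFin.
have hE x : ((h x)%:E * (p x)%:E = \sum_(y \in range h)
    ((y * \1_(h @^-1` [set y]) x)%:E * (p x)%:E))%E.
  rewrite -ge0_mule_fsuml => [|y]; last exact: nnfun_muleindic_ge0.
  by rewrite fsumEFin // -(fimfunE _ x).
under [RHS]eq_integral do rewrite hE.
have mi r : measurable_fun setT (fun x => (r * \1_(h @^-1` [set r]) x)%:E).
  by apply/measurable_EFinP; exact: measurable_funM.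
rewrite ge0_integral_fsum//; last by move=> y x _; exact: nnfun_muleindic_ge0.
rewrite ge0_integral_fsum//; last 2 first.
  - by move=> y; apply: emeasurable_funM => //; exact/measurable_EFinP.
  - by move=> y x _; rewrite mule_ge0 ?lee_fin// -lee_fin nnfun_muleindic_ge0.
apply: eq_fsbigr => r /[!inE] -[t _ htr].
have r0 : 0 <= r by rewrite -htr.
under eq_integral do rewrite EFinM.
rewrite ge0_integralZl//; last exact/measurable_EFinP.
under [RHS]eq_integral do rewrite EFinM -muleA.
rewrite ge0_integralZl//.
- congr (_ * _)%E; rewrite integral_indic// setIT muE//.
  rewrite [LHS]integral_mkcond; apply: eq_integral => x _.
  rewrite patchE indicE; case: ifPn => _; by rewrite ?mul1e ?mul0e.
- by apply: emeasurable_funM; exact/measurable_EFinP.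
- by move=> x _; rewrite mule_ge0 ?lee_fin.
Qed.

Lemma ge0_integral_density (f : T -> \bar R) :
  measurable_fun setT f -> (forall x, 0 <= f x)%E ->
  (\int[mu]_x f x = \int[m]_x (f x * (p x)%:E))%E.
Proof.
move=> mf f0; pose h := nnsfun_approx measurableT mf.
have hf x : (h n x)%:E @[n --> \oo] --> f x.
  by apply: cvg_nnsfun_approx.
have ndh x : {homo (fun n => (h n x)%:E) : a b / (a <= b)%N >-> (a <= b)%E}.
  by move=> a b ab; rewrite lee_fin; exact/lefP/nd_nnsfun_approx.
have := @cvg_monotone_convergence _ _ _ mu _ measurableT (fun n x => (h n x)%:E).
move=> /(_ _ _ (fun x _ => ndh x)) H1.
have := @cvg_monotone_convergence _ _ _ m _ measurableT
  (fun n x => ((h n x)%:E * (p x)%:E)%E) _ _ _.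
move=> H2.
have E1 : (\int[mu]_x (h n x)%:E @[n --> \oo] --> \int[mu]_x f x)%E.
  rewrite (eq_integral (fun x => limn (fun n => (h n x)%:E))).
    apply: H1 => //.
    + by move=> n; exact/measurable_EFinP.
    + by move=> n x _; rewrite lee_fin.
  by move=> x _; apply/esym/cvg_lim => //; exact: hf.
have E2 : (\int[m]_x ((h n x)%:E * (p x)%:E) @[n --> \oo] --> \int[m]_x
  (f x * (p x)%:E))%E.
  rewrite (eq_integral (fun x => limn (fun n => (h n x)%:E * (p x)%:E)%E)).
    apply: H2 => //.
    + by move=> n; apply: emeasurable_funM; exact/measurable_EFinP.
    + by move=> n x _; rewrite mule_ge0 ?lee_fin.
    + by move=> x _ a b ab; rewrite lee_wpmul2r ?lee_fin ?p_ge0//; have := ndh x a b ab;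
      rewrite lee_fin.
  by move=> x _; apply/esym/cvg_lim => //; apply: cvgeZr => //; exact: hf.
move: E2; under eq_fun do rewrite -nnsfun_integral_density.
by move=> /cvg_lim <-//; move/cvg_lim : E1 => <-.
Qed.

(** No integrability is involved: positive and negative parts are transported separately, so both
    sides agree even for an indeterminate difference. *)
Lemma integral_density (f : T -> R) : measurable_fun setT f ->
  (\int[mu]_x (f x)%:E = \int[m]_x (f x * p x)%:E)%E.
Proof.
move=> mf; rewrite integralE [RHS]integralE.
have mE : measurable_fun setT (EFin \o f) by exact/measurable_EFinP.
rewrite !ge0_integral_density//; last 2 first.
  exact: measurable_funeneg.
  exact: measurable_funepos.
congr (_ - _)%E; apply: eq_integral => x _.
  by rewrite !funeposE EFinM maxe_pMl ?lee_fin// mul0e.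
by rewrite !funenegE maxe_pMl ?lee_fin// mul0e EFinM mulNe.
Qed.

Lemma Rintegral_density (f : T -> R) : measurable_fun setT f ->
  \int[mu]_x f x = \int[m]_x (f x * p x).
Proof. by move=> mf; rewrite /Rintegral integral_density. Qed.

End density_integral.

(** * Affine and exponential substitutions for nonnegative integrands *)

Section substitution.
Context {R : realType}.
Local Notation leb := (@lebesgue_measure R).

Lemma ge0_integral_affine (c b : R) (f : R -> \bar R) : 0 < c ->
  measurable_fun setT f -> (forall x, 0 <= f x)%E ->
  (\int[leb]_x f x = c%:E * \int[leb]_x f (c * x + b)%R)%E.
Proof.
move=> c0 mf f0.
pose phi : R -> measurableTypeR R := fun x => c * x + b.
have mphi : measurable_fun setT phi.
  by apply: measurable_funD => //; exact: measurable_funM.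
pose k := NngNum (ltW c0).
pose nu : {measure set (measurableTypeR R) -> \bar R} :=
  mscale k (pushforward leb phi).
pose nu' := nu mphi.
transitivity (\int[nu']_x f x)%E.
  (* Lebesgue measure is determined by its values on half-open intervals, and c times its image
     under x |-> c x + b has the same ones. *)
  apply: eq_measure_integral => A mA _.
  apply: lebesgue_measure_unique => // X [[y z] _ <-].
  rewrite /nu' /nu/= /mscale/= /pushforward.
  rewrite (_ : phi @^-1` _ = `](y - b) / c, (z - b) / c]%classic); last first.
    apply/seteqP; split => x /=;
      rewrite !in_itv/= /phi ltr_pdivrMr// ler_pdivlMr// (mulrC x);
    by rewrite ltrBlDr lerBrDr.
  rewrite !lebesgue_measure_itv/= !lte_fin ltr_pM2r ?invr_gt0// ltrD2r.
  case: ifPn => _; rewrite ?mule0// -EFinB -EFinM; congr EFin.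
  by field; rewrite gt_eqF.
rewrite ge0_integral_mscale//=; congr (_ * _)%E.
by rewrite ge0_integral_pushforward.
Qed.

(** G may blow up at 0 and 1, as Beta integrands do. The substitution is made on the compact
    intervals [1/(n+1), n+1], and monotone convergence passes to the limit on both sides. *)
Lemma ge0_integral_expRN (G : R -> R) : {in `]0, 1[, continuous G} ->
  (forall x, 0 <= G x) ->
  (\int[leb]_(x in `]0%R, 1%R[) (G x)%:E =
   \int[leb]_(x in `]0%R, +oo[) (G (expR (- x)) * expR (- x))%:E)%E.
Proof.
move=> cG G0.
pose F (x : R) := expR (- x).
have F'E (x : R) : is_derive x (1 : R) F (- expR (- x)).
  by apply: trigger_derive; rewrite /= mulrN1.
have dF : F^`()%classic = (fun x => - expR (- x)).
  by apply/funext => x; rewrite derive1E; apply: derive_val.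
have cF : continuous F.
  by move=> x; apply: continuous_comp; [exact: opp_continuous|exact: continuous_expR].
have cF' : continuous F^`()%classic by rewrite dF => x; apply: cvgN; exact: cF.
pose a n : R := n.+1%:R^-1; pose b n : R := n.+1%:R.
have a0 n : 0 < a n by rewrite invr_gt0.
have ab n : a n <= b n by rewrite (@le_trans _ _ 1)// ?invf_le1// ler1n.
have incA : nondecreasing_seq (fun n => `[a n, b n]%classic).
  move=> i j ij; rewrite subsetEset; apply: subset_itvScc; rewrite ?bnd_simp/=.
    by rewrite lef_pV2 ?posrE// ler_nat.
  by rewrite ler_nat.
have incB : nondecreasing_seq (fun n => `[F (b n), F (a n)]%classic).
  move=> i j ij; rewrite subsetEset; apply: subset_itvScc;
    rewrite ?bnd_simp/= /F ler_expR lerN2.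
    by rewrite ler_nat.
  by rewrite lef_pV2 ?posrE// ler_nat.
have UA : \bigcup_n `[a n, b n]%classic = `]0, +oo[%classic.
  apply/seteqP; split => [x [n _]|x] /=; rewrite !in_itv/=.
    by move=> /andP[anx _]; rewrite andbT (lt_le_trans (a0 n)).
  rewrite andbT => x0.
  (* n + 1 must exceed x for the right end and 1/x for the left end. *)
  exists (Num.truncn (Num.max x x^-1)) => //=; rewrite in_itv/=.
  have := truncnS_gt (Num.max x x^-1); rewrite gt_max => /andP[h1 h2].
  by rewrite (ltW h1) andbT /a -[leRHS]invrK lef_pV2 ?posrE ?invr_gt0// ltW.
have UB : \bigcup_n `[F (b n), F (a n)]%classic = `]0, 1[%classic.
  apply/seteqP; split => [x [n _]|x] /=; rewrite !in_itv/=.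
    move=> /andP[h1 h2]; rewrite (lt_le_trans (expR_gt0 _) h1)/= (le_lt_trans h2)//.
    by rewrite /F -expR0 ltr_expR oppr_lt0.
  move=> /andP[x0 x1].
  have : `]0, +oo[%classic (- ln x) by rewrite /= in_itv/= andbT oppr_gt0 ln_lt0// x0.
  rewrite -UA => -[n _]/=; rewrite in_itv/= => /andP[h1 h2]; exists n => //=.
  rewrite in_itv/= /F; apply/andP; split.
    by rewrite -[leRHS](lnK x0) ler_expR lerNl.
  by rewrite -[leLHS](lnK x0) ler_expR lerNr.
have mG : measurable_fun (`]0%R, 1%R[ : set R) G.
  by apply: open_continuous_measurable_fun => // x; rewrite inE; exact: cG.
have mGF : measurable_fun (`]0%R, +oo[ : set R) (fun x => G (expR (- x)) * expR (- x)).
  apply: open_continuous_measurable_fun => // x /[!inE]/=; rewrite in_itv/= andbT => x0.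
  apply: (@cvgM _ _ _ _ (G \o F) F); last exact: cF.
  apply: (@continuous_comp _ _ _ F G); first exact: cF.
  by apply: cG; rewrite in_itv/= expR_gt0 -expR0 ltr_expR oppr_lt0.
rewrite -UA -UB.
have B1 : (\int[leb]_(x in `[a n, b n]%classic) (G (expR (- x)) * expR (- x))%:E
  @[n --> \oo] -->
   \int[leb]_(x in \bigcup_n `[a n, b n]%classic) (G (expR (- x)) * expR (- x))%:E)%E.
  apply: (@ge0_nondecreasing_set_cvg_integral _ (measurableTypeR R) R _
    (fun x : R => (G (expR (- x)) * expR (- x))%:E) leb incA) => //.
  - move=> n; apply/measurable_EFinP; apply: measurable_funS mGF => //.
    by rewrite -UA => x xn; exists n.
  - by move=> n x _; rewrite lee_fin mulr_ge0 ?expR_ge0.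
have B2 : (\int[leb]_(x in `[F (b n), F (a n)]%classic) (G x)%:E @[n --> \oo] -->
   \int[leb]_(x in \bigcup_n `[F (b n), F (a n)]%classic) (G x)%:E)%E.
  apply: (@ge0_nondecreasing_set_cvg_integral _ (measurableTypeR R) R _
    (fun x : R => (G x)%:E) leb incB) => //.
  - move=> n; apply/measurable_EFinP; apply: measurable_funS mG => //.
    by rewrite -UB => x xn; exists n.
  - by move=> n x _; rewrite lee_fin.
move/cvg_lim : B1 => <-//; move/cvg_lim : B2 => <-//.
congr (limn _); apply/funext => n.
rewrite (integration_by_substitution_decreasing (ab n))//.
- by apply: eq_integral => x _; rewrite dF/= /GRing.mul/= opprK.
- by move=> x y _ _ xy; rewrite /F ltr_expR ltrN2.
- by apply/cvg_ex; exists (F^`()%classic (a n)); apply: cvg_at_right_filter; exact: cF'.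
- by apply/cvg_ex; exists (F^`()%classic (b n)); apply: cvg_at_left_filter; exact: cF'.
- split.
  + by move=> x _; apply: ex_derive.
  + by apply: cvg_at_right_filter; exact: cF.
  + by apply: cvg_at_left_filter; exact: cF.
- apply: continuous_in_subspaceT => x; rewrite inE/= => xab; apply: cG.
  have : (\bigcup_n `[F (b n), F (a n)]%classic) x by exists n.
  by rewrite UB.
Qed.

End substitution.

(** * The Gamma and Beta integrals *)

Section gamma_beta.
Context {R : realType}.
Local Notation leb := (@lebesgue_measure R).

(* Extending x^(a - 1) by 0 to x <= 0 lets all integrals range over the whole line,
   where affine substitutions have no side conditions on the domain. *)
Definition pos_pow (a x : R) : R := if 0 < x then x `^ (a - 1) else 0.

Lemma pos_pow_ge0 a x : 0 <= pos_pow a x.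
Proof. by rewrite /pos_pow; case: ifP => _; rewrite ?powR_ge0. Qed.

Lemma pos_powE a x : 0 < x -> pos_pow a x = x `^ (a - 1).
Proof. by rewrite /pos_pow => ->. Qed.

Lemma pos_pow_le0 a x : x <= 0 -> pos_pow a x = 0.
Proof. by rewrite /pos_pow leNgt => /negbTE ->. Qed.

Lemma measurable_pos_pow a : measurable_fun setT (pos_pow a).
Proof.
apply: measurable_fun_if => //.
- exact: measurable_fun_ltr.
- by apply: measurable_funTS; exact: measurable_powR.
Qed.

Lemma pos_powM a c x : 0 < c -> pos_pow a (c * x) = c `^ (a - 1) * pos_pow a x.
Proof.
move=> c0; rewrite /pos_pow pmulr_rgt0//; case: ifPn => x0; last by rewrite mulr0.
by rewrite powRM// ltW.
Qed.

Lemma pos_pow_mulXn a x n : pos_pow a x * x ^+ n = pos_pow (a + n%:R) x.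
Proof.
rewrite /pos_pow; case: ifPn => x0; last by rewrite mul0r.
by rewrite -powR_mulrn ?(ltW x0)// -powRD ?(gt_eqF x0) ?implybT//; congr (_ `^ _); ring.
Qed.

Definition gamma_w (a x : R) : R := pos_pow a x * expR (- x).

Lemma gamma_w_ge0 a x : 0 <= gamma_w a x.
Proof. by rewrite mulr_ge0 ?pos_pow_ge0 ?expR_ge0. Qed.

Lemma measurable_gamma_w a : measurable_fun setT (gamma_w a).
Proof.
apply: measurable_funM; first exact: measurable_pos_pow.
by apply: measurableT_comp => //; exact: measurable_expR.
Qed.

Lemma measurable_EFin_gamma_w a : measurable_fun setT (fun x => (gamma_w a x)%:E).
Proof. by apply/measurable_EFinP; exact: measurable_gamma_w. Qed.

Definition EGamma a : \bar R := (\int[leb]_x (gamma_w a x)%:E)%E.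
Definition EBeta a b : \bar R :=
  (\int[leb]_x (pos_pow a x * pos_pow b (1 - x))%:E)%E.

Lemma EGamma_ge0 a : (0 <= EGamma a)%E.
Proof. by apply: integral_ge0 => x _; rewrite lee_fin gamma_w_ge0. Qed.

Lemma EBeta_ge0 a b : (0 <= EBeta a b)%E.
Proof. by apply: integral_ge0 => x _; rewrite lee_fin mulr_ge0 ?pos_pow_ge0. Qed.

Lemma GammaE a : Gamma a = fine (EGamma a).
Proof.
rewrite /Gamma /Rintegral integral_mkcond; congr fine; apply: eq_integral => x _.
rewrite patchE; case: ifPn => [|].
  by rewrite inE/= in_itv/= andbT /gamma_w => x0; rewrite pos_powE.
rewrite notin_setE/= in_itv/= andbT => /negP; rewrite -leNgt => x0.
by rewrite /gamma_w pos_pow_le0// mul0r.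
Qed.

Lemma gamma_pdfE a x : gamma_pdf a x = gamma_w a x / Gamma a.
Proof.
rewrite /gamma_pdf patchE; case: ifPn => [|].
  by rewrite inE/= in_itv/= andbT /gamma_w => x0; rewrite pos_powE.
rewrite notin_setE/= in_itv/= andbT => /negP; rewrite -leNgt => x0.
by rewrite /gamma_w pos_pow_le0// !mul0r.
Qed.

(* Up to a constant, the joint density of (X, X + Y) for independent X ~ Gamma(a)
   and Y ~ Gamma(b). *)
Definition conv_w a b (xz : R * R) : R :=
  pos_pow a xz.1 * pos_pow b (xz.2 - xz.1) * expR (- xz.2).

Lemma conv_w_ge0 a b xz : 0 <= conv_w a b xz.
Proof. by rewrite !mulr_ge0 ?pos_pow_ge0 ?expR_ge0. Qed.

Lemma measurable_conv_w a b : measurable_fun setT (conv_w a b).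
Proof.
apply: measurable_funM.
  apply: measurable_funM.
    exact: (measurableT_comp (measurable_pos_pow a)).
  apply: (measurableT_comp (measurable_pos_pow b)).
  exact: measurable_funB.
apply: measurableT_comp; first exact: measurable_expR.
exact: measurableT_comp.
Qed.

Lemma integral_conv_w2 a b x :
  (\int[leb]_z (conv_w a b (x, z))%:E = (gamma_w a x)%:E * EGamma b)%E.
Proof.
rewrite /EGamma (@ge0_integral_affine _ 1 (- x) (fun y => (gamma_w b y)%:E))//;
  last 2 first.
- exact: measurable_EFin_gamma_w.
- by move=> y; rewrite lee_fin gamma_w_ge0.
rewrite mul1e -ge0_integralZl//.
- apply: eq_integral => z _; rewrite -EFinM; congr EFin.
  rewrite /conv_w /gamma_w /= mul1r [RHS]mulrACA -expRD.
  by congr (_ * expR _); ring.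
- apply/measurable_EFinP; apply: (measurableT_comp (measurable_gamma_w b)).
  by apply: measurable_funD => //; exact: measurable_funM.
- by move=> y _; rewrite lee_fin gamma_w_ge0.
- by rewrite lee_fin gamma_w_ge0.
Qed.

Lemma measurable_beta_w a b :
  measurable_fun setT (fun x => pos_pow a x * pos_pow b (1 - x)).
Proof.
apply: measurable_funM; first exact: measurable_pos_pow.
by apply: (measurableT_comp (measurable_pos_pow b)); exact: measurable_funB.
Qed.

(** For z > 0 the substitution x = z r separates the variables: the powers of z collect into z^(a +
    b - 1), and the Beta integrand in r remains. For z <= 0 no x satisfies 0 < x < z. *)
Lemma integral_conv_w1 a b z :
  (\int[leb]_x (conv_w a b (x, z))%:E = (gamma_w (a + b) z)%:E * EBeta a b)%E.
Proof.
have [z0|z0] := leP z 0.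
  rewrite /gamma_w pos_pow_le0// mul0r mul0e.
  apply: integral0_eq => x _; rewrite /conv_w/=.
  have [x0|x0] := leP x 0; first by rewrite pos_pow_le0// !mul0r.
  by rewrite (@pos_pow_le0 b) ?mulr0 ?mul0r//; lra.
rewrite (@ge0_integral_affine _ z 0 (fun x => (conv_w a b (x, z))%:E))//; last 2 first.
- by apply/measurable_EFinP/(measurableT_comp (measurable_conv_w a b));
  exact: measurable_fun_pair.
- by move=> x; rewrite lee_fin conv_w_ge0.
have E x : (conv_w a b (z * x + 0, z))%:E =
   ((z `^ (a - 1) * z `^ (b - 1) * expR (- z))%:E *
     (pos_pow a x * pos_pow b (1 - x))%:E)%E.
  rewrite -EFinM; congr EFin; rewrite /conv_w/= addr0.
  rewrite (_ : z - z * x = z * (1 - x)); last by ring.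
  by rewrite !pos_powM//; ring.
under eq_integral do rewrite E.
rewrite ge0_integralZl//; last 3 first.
- by apply/measurable_EFinP; exact: measurable_beta_w.
- by move=> x _; rewrite lee_fin mulr_ge0 ?pos_pow_ge0.
- by rewrite lee_fin !mulr_ge0 ?powR_ge0 ?expR_ge0.
rewrite muleA -EFinM; congr (_%:E * _)%E.
rewrite /gamma_w pos_powE// -powRD ?(gt_eqF z0) ?implybT//.
rewrite (_ : a + b - 1 = a - 1 + (b - 1) + 1); last by ring.
by rewrite [in RHS]powRD ?(gt_eqF z0) ?implybT// powRr1 ?ltW//; ring.
Qed.

(* Working in [\bar R] makes Tonelli applicable before the integrals are known to
   be finite. *)
Lemma EGammaM a b : (EGamma a * EGamma b = EGamma (a + b) * EBeta a b)%E.
Proof.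
have mk : measurable_fun setT (fun xz => (conv_w a b xz)%:E).
  by apply/measurable_EFinP; exact: measurable_conv_w.
have k0 xz : (0 <= (conv_w a b xz)%:E)%E by rewrite lee_fin conv_w_ge0.
have := @fubini_tonelli _ _ _ _ _ leb leb _ mk k0.
under eq_integral do rewrite integral_conv_w2.
under [RHS]eq_integral do rewrite integral_conv_w1.
rewrite ge0_integralZr//; last 3 first.
- exact: measurable_EFin_gamma_w.
- by move=> x _; rewrite lee_fin gamma_w_ge0.
- exact: EGamma_ge0.
rewrite ge0_integralZr//; last 3 first.
- exact: measurable_EFin_gamma_w.
- by move=> x _; rewrite lee_fin gamma_w_ge0.
- exact: EBeta_ge0.
Qed.

Lemma continuous_powR_gt0 (p x : R) : 0 < x -> {for x, continuous (fun y => y `^ p)}.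
Proof.
move=> x0; apply: differentiable_continuous; apply/derivable1_diffP.
by have /(_ x0) := @is_derive1_powR _ p x => -[].
Qed.

(** The substitution r = e^(-s), which makes the Laplace transform of the law of tau a Beta
    integral. *)
Lemma EBeta_expR a b : EBeta a b =
  (\int[leb]_(x in `]0%R, +oo[) (expR (- (a * x)) * (1 - expR (- x)) `^ (b - 1))%:E)%E.
Proof.
transitivity (\int[leb]_(x in `]0%R, 1%R[) (x `^ (a - 1) * (1 - x) `^ (b - 1))%:E)%E.
  rewrite [RHS]integral_mkcond; apply: eq_integral => x _.
  rewrite patchE; case: ifPn => [|].
    rewrite inE/= in_itv/= => /andP[x0 x1]; rewrite !pos_powE//; lra.
  rewrite notin_setE/= in_itv/= => /negP.
  rewrite negb_and -!leNgt => /orP[x0|x1]; first by rewrite pos_pow_le0// mul0r.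
  by rewrite (@pos_pow_le0 b) ?mulr0//; lra.
rewrite (@ge0_integral_expRN _ (fun x => x `^ (a - 1) * (1 - x) `^ (b - 1))).
- apply: eq_integral => x _; congr EFin.
  rewrite mulrAC -expRM -expRD; congr (expR _ * _); ring.
- move=> x; rewrite in_itv/= => /andP[x0 x1].
  apply: cvgM; first exact: continuous_powR_gt0.
  apply: (@continuous_cvg _ _ _ _ _ _ (fun y : R => y `^ (b - 1))).
    by apply: continuous_powR_gt0; lra.
  by apply: cvgB; [exact: cvg_cst|exact: cvg_id].
- by move=> x; rewrite mulr_ge0 ?powR_ge0.
Qed.

Lemma EGamma1 : EGamma 1 = 1%E.
Proof.
rewrite -(@integral_exponential_pdf R 1)// /EGamma.
rewrite [RHS](_ : _ = \int[leb]_(x in `[0%R, +oo[) (expR (- x))%:E)%E; last first.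
  rewrite [RHS]integral_mkcond; apply: eq_integral => x _.
  by rewrite /exponential_pdf !patchE; case: ifPn => // _; rewrite mul1r mulN1r.
rewrite -integral_itv_obnd_cbnd; last first.
  apply/measurable_EFinP; apply: measurable_funTS.
  by apply: measurableT_comp => //; exact: measurable_expR.
rewrite [RHS]integral_mkcond; apply: eq_integral => x _.
rewrite patchE /gamma_w; case: ifPn => [|].
  by rewrite inE/= in_itv/= andbT => x0; rewrite pos_powE// subrr powRr0 mul1r.
rewrite notin_setE/= in_itv/= andbT => /negP; rewrite -leNgt => x0.
by rewrite pos_pow_le0// mul0r.
Qed.

(** In exponential form the second factor has exponent 0, which leaves the integral of e^(-a x). *)
Lemma EBeta1 a : 0 < a -> EBeta a 1 = (a^-1)%:E.
Proof.
move=> a0; rewrite EBeta_expR.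
transitivity (\int[leb]_x (gamma_w 1 (a * x + 0))%:E)%E; last first.
  have := @ge0_integral_affine _ a 0 (fun x => (gamma_w 1 x)%:E) a0.
  rewrite -/(EGamma 1) EGamma1 => H.
  rewrite -[RHS]mule1 H.
  - by rewrite muleA -EFinM mulVf ?mul1e// gt_eqF.
  - exact: measurable_EFin_gamma_w.
  - by move=> x; rewrite lee_fin gamma_w_ge0.
rewrite [LHS]integral_mkcond; apply: eq_integral => x _.
rewrite patchE /gamma_w addr0; case: ifPn => [|].
  rewrite inE/= in_itv/= andbT => x0.
  by rewrite subrr powRr0 mulr1 pos_powE ?mulr_gt0// subrr powRr0 mul1r.
rewrite notin_setE/= in_itv/= andbT => /negP; rewrite -leNgt => x0.
by rewrite pos_pow_le0 ?mul0r// pmulr_rle0.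
Qed.

(** The Beta identity at b = 1 takes the place of an integration by parts, and it makes sense before
    finiteness is known. *)
Lemma EGammaS a : 0 < a -> (EGamma (a + 1) = a%:E * EGamma a)%E.
Proof.
move=> a0; have := EGammaM a 1; rewrite EGamma1 mule1 EBeta1// => ->.
by rewrite muleC -muleA -EFinM mulVf ?mule1// gt_eqF.
Qed.

Lemma EGamma_nat n : EGamma n.+1%:R = (n`!%:R)%:E.
Proof.
elim: n => [|n IH]; first by rewrite EGamma1.
by rewrite -natr1 EGammaS// IH -EFinM factS natrM.
Qed.

(** x^(b-1) is at most x^(a-1) for x <= 1 and at most x^(c-1) for x >= 1. Comparison with integer
    arguments will give both finiteness and positivity. *)
Lemma EGamma_le a b c : a <= b <= c -> (EGamma b <= EGamma a + EGamma c)%E.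
Proof.
move=> /andP[ab bc]; rewrite /EGamma -ge0_integralD//; last 4 first.
- by move=> x _; rewrite lee_fin gamma_w_ge0.
- exact: measurable_EFin_gamma_w.
- by move=> x _; rewrite lee_fin gamma_w_ge0.
- exact: measurable_EFin_gamma_w.
apply: ge0_le_integral => //.
- by move=> x _; rewrite lee_fin gamma_w_ge0.
- exact: measurable_EFin_gamma_w.
- by apply: emeasurable_funD; exact: measurable_EFin_gamma_w.
move=> x _; rewrite -EFinD lee_fin /gamma_w -mulrDl ler_wpM2r ?expR_ge0//.
have [x0|x0] := leP x 0; first by rewrite !pos_pow_le0// addr0.
rewrite !pos_powE//.
have [x1|x1] := leP x 1.
  by rewrite (@le_trans _ _ (x `^ (a - 1)))// ?lerDl ?powR_ge0// ger_powR ?x0// lerD2r.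
by rewrite (@le_trans _ _ (x `^ (c - 1)))// ?lerDr ?powR_ge0// ler_powR ?(ltW x1)//
  lerD2r.
Qed.

Lemma EGamma_addn a n : 0 < a -> exists2 c : R, 0 < c &
  (EGamma (a + n%:R) = c%:E * EGamma a)%E.
Proof.
move=> a0; elim: n => [|n [c c0 IH]]; first by exists 1; rewrite ?addr0 ?mul1e.
exists ((a + n%:R) * c); first by rewrite mulr_gt0// ltr_pwDl.
by rewrite -natr1 addrA EGammaS ?ltr_pwDl// IH muleA -EFinM.
Qed.

Lemma EGamma_fin_num a : 0 < a -> EGamma a \is a fin_num.
Proof.
move=> a0; rewrite ge0_fin_numE ?EGamma_ge0//.
(* There may be no positive integer below a, but a + 1 lies between 1 and [truncn a] + 2. The
   functional equation then brings finiteness back to a. *)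
have H : (EGamma (a + 1) < +oo)%E.
  pose n := Num.truncn a.
  apply: (@le_lt_trans _ _ (EGamma 1%:R + EGamma n.+2%:R)%E).
    apply: EGamma_le; rewrite lerDr (ltW a0)/= -[leRHS]natr1 lerD2r.
    exact/ltW/truncnS_gt.
  by rewrite !EGamma_nat -EFinD ltry.
move: H; rewrite EGammaS//; case: (EGamma a) (EGamma_ge0 a) => // [r _ _|_].
  by rewrite ltry.
by rewrite gt0_muley ?lte_fin.
Qed.

Lemma EGammaE a : 0 < a -> EGamma a = (Gamma a)%:E.
Proof. by move=> a0; rewrite GammaE fineK// EGamma_fin_num. Qed.

(** If Gamma vanished at a, it would vanish at a + n + 1 too; an integer n + 1 between these two
    points would then give n! <= 0. *)
Lemma Gamma_gt0 (a : R) : 0 < a -> 0 < Gamma a.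
Proof.
move=> a0; rewrite lt_neqAle Gamma_ge0 andbT eq_sym; apply/negP => /eqP G0.
pose n := Num.truncn a.
have [c c0 Hc] := EGamma_addn n.+1 a0.
have := @EGamma_le a n.+1%:R (a + n.+1%:R).
rewrite (ltW (truncnS_gt a)) lerDr (ltW a0) => /(_ isT).
by rewrite Hc (EGammaE a0) G0 mule0 adde0 EGamma_nat lee_fin leNgt ltr0n fact_gt0.
Qed.

Lemma GammaS (a : R) : 0 < a -> Gamma (a + 1) = a * Gamma a.
Proof.
move=> a0; apply: EFin_inj; rewrite EFinM -!EGammaE//; last by rewrite addr_gt0.
exact: EGammaS.
Qed.

Lemma EBetaE a b : 0 < a -> 0 < b ->
  EBeta a b = (Gamma a * Gamma b / Gamma (a + b))%:E.
Proof.
move=> a0 b0; have ab0 : 0 < a + b by rewrite addr_gt0.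
have G0 : Gamma (a + b) != 0 by rewrite gt_eqF// Gamma_gt0.
have := EGammaM a b; rewrite !EGammaE//.
move=> /(congr1 (fun x => ((Gamma (a + b))^-1)%:E * x))%E.
by rewrite [RHS]muleA -!EFinM mulVf// mul1e => <-; congr EFin; ring.
Qed.

End gamma_beta.

(** Tonelli handles the positive and negative parts separately, and [fine] is measurable, so
    sections with divergent integrals do no harm. *)
Lemma measurable_Rintegral_param d1 d2 (T1 : measurableType d1)
    (T2 : measurableType d2) (R : realType)
    (m1 : {sigma_finite_measure set T1 -> \bar R}) (h : T1 * T2 -> R) :
  measurable_fun setT h ->
  measurable_fun setT (fun z => \int[m1]_x h (x, z)).
Proof.
move=> mh; have mE : measurable_fun setT (EFin \o h) by exact/measurable_EFinP.
rewrite /Rintegral; apply: (measurableT_comp (fine_measurable measurableT)).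
rewrite (_ : (fun z => _) = fun z => (fubini_G m1 (EFin \o h)^\+ z -
    fubini_G m1 (EFin \o h)^\- z)%E); last first.
  apply/funext => z; rewrite integralE; congr (_ - _)%E.
    by apply: eq_integral => x _; rewrite !funeposE.
  by apply: eq_integral => x _; rewrite !funenegE.
apply: emeasurable_funB.
  apply: measurable_fun_fubini_tonelli_G => //; exact: measurable_funepos.
by apply: measurable_fun_fubini_tonelli_G => //; exact: measurable_funeneg.
Qed.

(** * Conditional expectations given by a joint density *)

(* [k] is a joint density of (X, Z), with marginal densities [p] and [q];
   E(f(X) | Z = z) is characterised by E(f(X) | Z = z) q(z) = int f(x) k(x, z) dx. *)
Section disintegration.
Context d1 d2 (T1 : measurableType d1) (T2 : measurableType d2) (R : realType).
Variables (m1 : {sigma_finite_measure set T1 -> \bar R})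
  (m2 : {sigma_finite_measure set T2 -> \bar R}).
Variables (k : T1 * T2 -> R) (p : T1 -> R) (q : T2 -> R).
Variables (mu : {measure set T1 -> \bar R}) (nu : {measure set T2 -> \bar R}).
Hypotheses (k_ge0 : forall xz, 0 <= k xz) (mk : measurable_fun setT k).
Hypotheses (p_ge0 : forall x, 0 <= p x) (mp : measurable_fun setT p)
  (muE : forall A, measurable A -> mu A = (\int[m1]_(x in A) (p x)%:E)%E).
Hypotheses (q_ge0 : forall z, 0 <= q z) (mq : measurable_fun setT q)
  (nuE : forall A, measurable A -> nu A = (\int[m2]_(z in A) (q z)%:E)%E).
Hypotheses (kp : forall x, (\int[m2]_z (k (x, z))%:E = (p x)%:E)%E)
  (kq : forall z, (\int[m1]_x (k (x, z))%:E = (q z)%:E)%E).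

(** The law of total expectation: by Tonelli, k is integrated over z first, which leaves the
    marginal density p. *)
Lemma ge0_integral_disintegration (f : T1 -> R) :
  measurable_fun setT f -> (forall x, 0 <= f x) ->
  (\int[m2]_z \int[m1]_x (f x * k (x, z))%:E = \int[mu]_x (f x)%:E)%E.
Proof.
move=> mf f0.
rewrite (ge0_integral_density p_ge0 mp muE)//; last exact/measurable_EFinP.
rewrite -(@fubini_tonelli _ _ _ _ _ m1 m2 (fun xz => (f xz.1 * k xz)%:E)).
- apply: eq_integral => x _; rewrite -kp -ge0_integralZl//.
  + by apply/measurable_EFinP; apply: (measurableT_comp mk).
  + by move=> z _; rewrite lee_fin.
  + by rewrite lee_fin.
- by apply/measurable_EFinP; apply: measurable_funM => //; exact: measurableT_comp.
- by move=> xz; rewrite lee_fin mulr_ge0.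
Qed.

(** Jensen's inequality for the square, in the form of a nonnegative conditional variance: expand
    the integral of (f - c)^2 k. *)
Lemma conditional_expectation_sqr (f : T1 -> R) z c : measurable_fun setT f ->
  c * q z = \int[m1]_x (f x * k (x, z)) ->
  ((c ^+ 2 * q z)%:E <= \int[m1]_x (f x ^+ 2 * k (x, z))%:E)%E.
Proof.
move=> mf cE.
have mkz : measurable_fun setT (fun x => k (x, z)) by apply: (measurableT_comp mk).
have ik : m1.-integrable setT (fun x => (k (x, z))%:E).
  apply/integrableP; split; first exact/measurable_EFinP.
  by under eq_integral do rewrite gee0_abs ?lee_fin//; rewrite kq ltry.
have [/eqP ->|foo] := boolP ((\int[m1]_x (f x ^+ 2 * k (x, z))%:E)%E == +oo%E).
  by rewrite leey.
have if2 : m1.-integrable setT (fun x => (f x ^+ 2 * k (x, z))%:E).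
  apply/integrableP; split.
    by apply/measurable_EFinP/measurable_funM => //; exact: measurable_funX.
  rewrite (eq_integral (fun x => (f x ^+ 2 * k (x, z))%:E)) ?ltey// => x _.
  by rewrite gee0_abs// lee_fin mulr_ge0 ?sqr_ge0.
(* Since |f| <= f^2 + 1, a finite second moment ensures that c is a true mean and not a default
   value. *)
have i1 : m1.-integrable setT (fun x => (f x * k (x, z))%:E).
  apply: (le_integrable measurableT _ _ (integrableD measurableT if2 ik)).
    by apply/measurable_EFinP/measurable_funM.
  move=> x _; rewrite -EFinD !abse_EFin lee_fin normrM (ger0_norm (k_ge0 _)).
  rewrite -[X in _ + X]mul1r -mulrDl [leRHS]ger0_norm; last first.
    by rewrite mulr_ge0// addr_ge0// sqr_ge0.
  rewrite ler_wpM2r// -(real_normK (num_real (f x))).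
  by have := normr_ge0 (f x); nra.
have : (0 <= \int[m1]_x ((f x - c) ^+ 2 * k (x, z))%:E)%E.
  by apply: integral_ge0 => x _; rewrite lee_fin mulr_ge0 ?sqr_ge0.
have E x : (((f x - c) ^+ 2 * k (x, z))%:E = (f x ^+ 2 * k (x, z))%:E +
   ((- (2 * c))%:E * (f x * k (x, z))%:E + (c ^+ 2)%:E * (k (x, z))%:E))%E.
  by rewrite -!EFinM -!EFinD; congr EFin; ring.
under eq_integral do rewrite E.
have i1c := integrableZl measurableT (- (2 * c)) i1.
have ikc := integrableZl measurableT (c ^+ 2) ik.
rewrite integralD//; last exact: integrableD.
rewrite integralD// !integralZl// kq.
have -> : (\int[m1]_x (f x * k (x, z))%:E)%E = (c * q z)%:E.
  by rewrite cE /Rintegral fineK//; exact: integrable_fin_num i1.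
rewrite -[(\int[m1]_x (f x ^+ 2 * k (x, z))%:E)%E]fineK; last first.
  exact: integrable_fin_num if2.
by rewrite -!EFinM -!EFinD !lee_fin => H; nra.
Qed.

Lemma conditional_expectation_L2 (f : T1 -> R) (G : T2 -> R) :
  f \in Lfun mu 2%:E -> measurable_fun setT G ->
  (forall z, G z * q z = \int[m1]_x (f x * k (x, z))) -> G \in Lfun nu 2%:E.
Proof.
move=> /Lfun2P[mf fL] mG GE; apply/Lfun2P; split => //.
apply: le_lt_trans fL.
rewrite -ge0_integral_disintegration;
  [|exact: measurable_funX|by move=> x; rewrite sqr_ge0].
rewrite (ge0_integral_density q_ge0 mq nuE)//; last 2 first.
- by apply/measurable_EFinP; exact: measurable_funX.
- by move=> x; rewrite lee_fin sqr_ge0.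
apply: ge0_le_integral => //.
- by move=> z _; rewrite mule_ge0 ?lee_fin ?sqr_ge0.
- by apply: emeasurable_funM; apply/measurable_EFinP => //; exact: measurable_funX.
- apply: (@measurable_fun_fubini_tonelli_G _ _ T1 T2 R m1
  (fun xz => (f xz.1 ^+ 2 * k xz)%:E)).
    apply/measurable_EFinP/measurable_funM => //; apply: measurable_funX.
    exact: measurableT_comp.
  by move=> xz; rewrite lee_fin mulr_ge0 ?sqr_ge0.
- by move=> z _; rewrite -EFinM; exact: conditional_expectation_sqr.
Qed.

End disintegration.

(** * Mutual adjointness of the two conditional expectations *)

Section disintegration_adjoint.
Context d1 d2 (T1 : measurableType d1) (T2 : measurableType d2) (R : realType).
Variables (m1 : {sigma_finite_measure set T1 -> \bar R})
  (m2 : {sigma_finite_measure set T2 -> \bar R}).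
Variables (k : T1 * T2 -> R) (p : T1 -> R) (q : T2 -> R).
Variables (mu : {measure set T1 -> \bar R}) (nu : {measure set T2 -> \bar R}).
Hypotheses (k_ge0 : forall xz, 0 <= k xz) (mk : measurable_fun setT k).
Hypotheses (p_ge0 : forall x, 0 <= p x) (mp : measurable_fun setT p)
  (muE : forall A, measurable A -> mu A = (\int[m1]_(x in A) (p x)%:E)%E).
Hypotheses (q_ge0 : forall z, 0 <= q z) (mq : measurable_fun setT q)
  (nuE : forall A, measurable A -> nu A = (\int[m2]_(z in A) (q z)%:E)%E).
Hypotheses (kp : forall x, (\int[m2]_z (k (x, z))%:E = (p x)%:E)%E)
  (kq : forall z, (\int[m1]_x (k (x, z))%:E = (q z)%:E)%E).

(** Exchanging the variables lets the disintegration formula serve for the other marginal. *)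
Let ks zx := k (zx.2, zx.1).
Let mks : measurable_fun setT ks.
Proof. by apply: (measurableT_comp mk); exact: measurable_fun_pair. Qed.

(** Dominated by f^2 k + g^2 k, whose two integrals are the squared norms of f and g. *)
Let integrable_fgk f g : f \in Lfun mu 2%:E -> g \in Lfun nu 2%:E ->
  (m1 \x m2)%E.-integrable setT (fun xz => (f xz.1 * g xz.2 * k xz)%:E).
Proof.
move=> fL gL; have [mf f2] := (Lfun2P _ _).1 fL; have [mg g2] := (Lfun2P _ _).1 gL.
have mf1 : measurable_fun setT (fun xz : T1 * T2 => f xz.1) by exact: measurableT_comp.
have mg2 : measurable_fun setT (fun xz : T1 * T2 => g xz.2) by exact: measurableT_comp.
have fk0 xz : (0 <= (f xz.1 ^+ 2 * k xz)%:E)%E.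
  by rewrite lee_fin mulr_ge0 ?sqr_ge0.
have gk0 xz : (0 <= (g xz.2 ^+ 2 * k xz)%:E)%E.
  by rewrite lee_fin mulr_ge0 ?sqr_ge0.
have mfk : measurable_fun setT (fun xz => (f xz.1 ^+ 2 * k xz)%:E).
  by apply/measurable_EFinP/measurable_funM => //; exact: measurable_funX.
have mgk : measurable_fun setT (fun xz => (g xz.2 ^+ 2 * k xz)%:E).
  by apply/measurable_EFinP/measurable_funM => //; exact: measurable_funX.
have i1 : (m1 \x m2)%E.-integrable setT (fun xz => (f xz.1 ^+ 2 * k xz)%:E).
  apply/integrableP; split => //.
  under eq_integral do rewrite gee0_abs//.
  rewrite fubini_tonelli2//.
  apply: le_lt_trans f2.
  rewrite -(ge0_integral_disintegration k_ge0 mk p_ge0 mp muE kp)//.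
  - exact: measurable_funX.
  - by move=> x; rewrite sqr_ge0.
have i2 : (m1 \x m2)%E.-integrable setT (fun xz => (g xz.2 ^+ 2 * k xz)%:E).
  apply/integrableP; split => //.
  under eq_integral do rewrite gee0_abs//.
  rewrite fubini_tonelli1//.
  apply: le_lt_trans g2.
  rewrite -(@ge0_integral_disintegration _ _ _ _ _ m2 m1 ks q nu _ mks q_ge0 mq nuE)//.
  - by move=> zx; exact: k_ge0.
  - exact: measurable_funX.
  - by move=> x; rewrite sqr_ge0.
apply: (le_integrable measurableT _ _ (integrableD measurableT i1 i2)).
  by apply/measurable_EFinP/measurable_funM => //; exact: measurable_funM.
move=> xz _; rewrite -EFinD !abse_EFin lee_fin normrM (ger0_norm (k_ge0 _)).
rewrite -mulrDl [leRHS]ger0_norm; last by rewrite mulr_ge0// addr_ge0// sqr_ge0.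
rewrite ler_wpM2r// normrM -(real_normK (num_real (f xz.1)))
  -(real_normK (num_real (g xz.2))).
by have := sqr_ge0 (`|f xz.1| - `|g xz.2|); have := normr_ge0 (f xz.1);
  have := normr_ge0 (g xz.2); nra.
Qed.

Lemma L2dot_conditional_expectation (f : T1 -> R) (G g : T2 -> R) :
  f \in Lfun mu 2%:E -> g \in Lfun nu 2%:E -> measurable_fun setT G ->
  (forall z, G z * q z = \int[m1]_x (f x * k (x, z))) ->
  L2dot nu G g = fine (\int[m1 \x m2]_xz (f xz.1 * g xz.2 * k xz)%:E)%E.
Proof.
move=> fL gL mG GE; have mg := Lfun2_measurable gL.
have ifgk := integrable_fgk fL gL.
rewrite /L2dot (Rintegral_density q_ge0 mq nuE); last exact: measurable_funM.
rewrite -integral21_prod_meas1// /Rintegral; congr fine.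
have := ae_integrable2 ifgk; have mf := Lfun2_measurable fL.
move=> H; apply: ae_eq_integral => //.
- by apply/measurable_EFinP; apply: measurable_funM => //; exact: measurable_funM.
- exact: measurable_fubini_G ifgk.
apply: filterS H => z iz _ /=.
rewrite mulrAC GE /fubini_G.
(* If g(z) = 0 both sides vanish, whatever the integral of f k. Otherwise dividing the integrable
   section by g(z) shows that f k is integrable in x. *)
have [g0|g0] := eqVneq (g z) 0.
  by rewrite g0 mulr0 integral0_eq// => x _; rewrite mulr0 mul0r.
have ifk : m1.-integrable setT (fun x => (f x * k (x, z))%:E).
  have := integrableZl measurableT (g z)^-1 iz; apply: eq_integrable => // x _.
  by rewrite -EFinM; congr EFin; rewrite /=; field.
under eq_integral do rewrite /= mulrAC mulrC EFinM.
rewrite integralZl// mulrC EFinM; congr (_ * _)%E.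
by rewrite /Rintegral fineK//; exact: integrable_fin_num ifk.
Qed.

(** Both inner products are the double integral of f(x) g(z) k(x, z), integrated in the two possible
    orders. *)
Lemma L2dot_conditional_expectation_adj (f : T1 -> R) (G g : T2 -> R) (H : T1 -> R) :
  f \in Lfun mu 2%:E -> g \in Lfun nu 2%:E ->
  measurable_fun setT G -> (forall z, G z * q z = \int[m1]_x (f x * k (x, z))) ->
  measurable_fun setT H -> (forall x, H x * p x = \int[m2]_z (g z * k (x, z))) ->
  L2dot nu G g = L2dot mu f H.
Proof.
move=> fL gL mG GE mH HE; rewrite (L2dot_conditional_expectation fL gL mG GE).
have ifgk := integrable_fgk fL gL; have mf := Lfun2_measurable fL.
rewrite /L2dot (Rintegral_density p_ge0 mp muE); last exact: measurable_funM.
rewrite -integral12_prod_meas1// /Rintegral; congr fine; apply/esym.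
have iae := ae_integrable1 ifgk.
apply: ae_eq_integral => //.
- by apply/measurable_EFinP; apply: measurable_funM => //; exact: measurable_funM.
- exact: measurable_fubini_F ifgk.
apply: filterS iae => x ix _ /=.
rewrite -mulrA HE /fubini_F.
have [f0|f0] := eqVneq (f x) 0.
  by rewrite f0 mul0r integral0_eq// => z _; rewrite !mul0r.
have igk : m2.-integrable setT (fun z => (g z * k (x, z))%:E).
  have := integrableZl measurableT (f x)^-1 ix; apply: eq_integrable => // z _.
  by rewrite -EFinM; congr EFin; rewrite /=; field.
under eq_integral do rewrite /= -mulrA EFinM.
rewrite integralZl// EFinM; congr (_ * _)%E.
by rewrite /Rintegral fineK//; exact: integrable_fin_num igk.
Qed.

End disintegration_adjoint.

(** * Scaling and affine substitution for signed integrals that may diverge *)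

Section signed_affine.
Context {R : realType}.
Local Notation leb := (@lebesgue_measure R).

(** As soon as A or B is infinite, both differences are infinite and [fine] sends them to 0. *)
Lemma fine_gt0_muleB (c : R) (A B : \bar R) : 0 < c ->
  (0 <= A)%E -> (0 <= B)%E -> fine (c%:E * A - c%:E * B) = c * fine (A - B).
Proof.
move=> c0; case: A => [a _||//]; case: B => [b _||//] //=.
- by rewrite mulrBr.
- by rewrite gt0_muley ?lte_fin// mulr0.
- by rewrite gt0_muley ?lte_fin// mulr0.
- by rewrite gt0_muley ?lte_fin// mulr0.
Qed.

Lemma Rintegral_gt0Zl d (T : measurableType d) (m : {measure set T -> \bar R})
    (c : R) (f : T -> R) : 0 < c -> measurable_fun setT f ->
  \int[m]_x (c * f x) = c * \int[m]_x f x.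
Proof.
move=> c0 mf; have mE : measurable_fun setT (EFin \o f) by exact/measurable_EFinP.
rewrite /Rintegral integralE [X in _ = c * fine X]integralE -fine_gt0_muleB//;
  [|by apply: integral_ge0..].
rewrite -ge0_integralZl//; [|exact: measurable_funepos|by rewrite lee_fin ltW].
rewrite -ge0_integralZl//; [|exact: measurable_funeneg|by rewrite lee_fin ltW].
congr (fine (_ - _)); apply: eq_integral => x _.
  by rewrite !funeposE maxe_pMr ?lee_fin ?(ltW c0)// mule0 EFinM.
by rewrite !funenegE maxe_pMr ?lee_fin ?(ltW c0)// mule0 EFinM muleN.
Qed.

Lemma Rintegral_affine (c b : R) (f : R -> R) : 0 < c ->
  measurable_fun setT f -> \int[leb]_x f x = c * \int[leb]_x f (c * x + b).
Proof.
move=> c0 mf; have mE : measurable_fun setT (EFin \o f) by exact/measurable_EFinP.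
rewrite /Rintegral integralE [X in _ = c * fine X]integralE.
have := @ge0_integral_affine _ c b (EFin \o f)^\+%E c0 (measurable_funepos mE).
move=> /(_ (fun=> funepos_ge0 _ _)) ->.
have := @ge0_integral_affine _ c b (EFin \o f)^\-%E c0 (measurable_funeneg mE).
move=> /(_ (fun=> funeneg_ge0 _ _)) ->.
rewrite fine_gt0_muleB//; [|by apply: integral_ge0..].
congr (_ * fine (_ - _)); apply: eq_integral => x _.
  by rewrite !funeposE.
by rewrite !funenegE.
Qed.

End signed_affine.

(** * The kernel Lambda and its adjoint *)

Section Lambda_theory.
Context {R : realType}.
Local Notation leb := (@lebesgue_measure R).
Variables (beta eps : R) (beta_gt0 : 0 < beta) (eps_gt0 : 0 < eps).

Let be_gt0 : 0 < beta + eps. Proof. exact: addr_gt0. Qed.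

Lemma nu_gammaE (gam : R) (A : set R) :
  nu_gamma gam A = (\int[leb]_(x in A) (gamma_pdf gam x)%:E)%E.
Proof. by []. Qed.

Definition joint_pdf (xz : R * R) : R :=
  conv_w eps beta xz / (Gamma eps * Gamma beta).

Lemma joint_pdf_ge0 xz : 0 <= joint_pdf xz.
Proof. by rewrite divr_ge0 ?conv_w_ge0// mulr_ge0 ?Gamma_ge0. Qed.

Lemma measurable_joint_pdf : measurable_fun setT joint_pdf.
Proof. by apply: measurable_funM => //; exact: measurable_conv_w. Qed.

Lemma integral_joint_pdf2 x :
  (\int[leb]_z (joint_pdf (x, z))%:E = (gamma_pdf eps x)%:E)%E.
Proof.
under eq_integral do rewrite /joint_pdf EFinM.
rewrite ge0_integralZr//; last 3 first.
- by apply/measurable_EFinP; apply: (measurableT_comp (measurable_conv_w eps beta)).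
- by move=> z _; rewrite lee_fin conv_w_ge0.
- by rewrite lee_fin invr_ge0 mulr_ge0 ?Gamma_ge0.
rewrite integral_conv_w2 EGammaE// -!EFinM gamma_pdfE; congr EFin.
by field; rewrite !gt_eqF ?Gamma_gt0.
Qed.

Lemma integral_joint_pdf1 z :
  (\int[leb]_x (joint_pdf (x, z))%:E = (gamma_pdf (beta + eps) z)%:E)%E.
Proof.
under eq_integral do rewrite /joint_pdf EFinM.
rewrite ge0_integralZr//; last 3 first.
- by apply/measurable_EFinP; apply: (measurableT_comp (measurable_conv_w eps beta)).
- by move=> x _; rewrite lee_fin conv_w_ge0.
- by rewrite lee_fin invr_ge0 mulr_ge0 ?Gamma_ge0.
rewrite integral_conv_w1 EBetaE// -!EFinM gamma_pdfE (addrC eps); congr EFin.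
by field; rewrite !gt_eqF ?Gamma_gt0.
Qed.

Lemma LambdaE (f : R -> R) z : Lambda beta eps f z = beta_cst beta eps *
  \int[leb]_r (f (r * z) * (pos_pow eps r * pos_pow beta (1 - r))).
Proof.
rewrite /Lambda Rintegral_mkcond; congr (_ * _); apply: eq_Rintegral => r _.
rewrite patchE; case: ifPn => [|].
  by rewrite inE/= in_itv/= => /andP[r0 r1]; rewrite !pos_powE ?subr_gt0// mulrA.
rewrite notin_setE/= in_itv/= => /negP.
rewrite negb_and -!leNgt => /orP[r0|r1]; first by rewrite pos_pow_le0// mul0r mulr0.
by rewrite (@pos_pow_le0 _ beta) ?mulr0// subr_le0.
Qed.

Lemma measurable_Lambda (f : R -> R) : measurable_fun setT f ->
  measurable_fun setT (Lambda beta eps f).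
Proof.
move=> mf; rewrite (_ : Lambda _ _ _ = fun z => beta_cst beta eps *
  \int[leb]_r (f (r * z) * (pos_pow eps r * pos_pow beta (1 - r)))); last first.
  by apply/funext => z; exact: LambdaE.
apply: measurable_funM => //.
apply: (@measurable_Rintegral_param _ _ _ _ R leb (fun rz : R * R =>
  f (rz.1 * rz.2) * (pos_pow eps rz.1 * pos_pow beta (1 - rz.1)))).
apply: measurable_funM.
  by apply: (measurableT_comp mf); exact: measurable_funM.
by apply: (measurableT_comp (measurable_beta_w eps beta)).
Qed.

(** The substitution x = z r identifies [Lambda] f with E(f(X) | X + Y = z). It holds at every z,
    since the default values of divergent integrals agree as well. *)
Lemma Lambda_joint_pdf (f : R -> R) z : measurable_fun setT f ->
  Lambda beta eps f z * gamma_pdf (beta + eps) z =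
  \int[leb]_x (f x * joint_pdf (x, z)).
Proof.
move=> mf; have [z0|z0] := leP z 0.
  rewrite gamma_pdfE /gamma_w pos_pow_le0// !mul0r mulr0.
  rewrite /Rintegral integral0_eq// => x _; rewrite /joint_pdf /conv_w/=.
  have [x0|x0] := leP x 0; first by rewrite pos_pow_le0// !mul0r mulr0.
  by rewrite (@pos_pow_le0 _ beta) ?(mulr0, mul0r)//; lra.
have mfj : measurable_fun setT (fun x => f x * joint_pdf (x, z)).
  by apply: measurable_funM => //; apply: (measurableT_comp measurable_joint_pdf).
rewrite (Rintegral_affine 0 z0 mfj) LambdaE.
(* The factor independent of r in the joint density at (z r, z). *)
set c := z `^ (eps - 1) * z `^ (beta - 1) * expR (- z) / (Gamma eps * Gamma beta).
have c0 : 0 < c.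
  by rewrite !mulr_gt0 ?powR_gt0 ?expR_gt0// invr_gt0 mulr_gt0 ?Gamma_gt0.
pose h r := f (r * z) * (pos_pow eps r * pos_pow beta (1 - r)).
have E r : f (z * r + 0) * joint_pdf (z * r + 0, z) = c * h r.
  rewrite addr0 /joint_pdf /conv_w/= (_ : z - z * r = z * (1 - r)); last by ring.
  by rewrite !pos_powM// /h /c (mulrC z r); ring.
under [in RHS]eq_Rintegral do rewrite E.
have mh : measurable_fun setT h.
  apply: measurable_funM; last exact: measurable_beta_w.
  by apply: (measurableT_comp mf); exact: measurable_funM.
rewrite Rintegral_gt0Zl// -/h mulrAC [RHS]mulrA; congr (_ * _).
rewrite gamma_pdfE /gamma_w pos_powE// /beta_cst /c.
have -> : z `^ (beta + eps - 1) = z `^ (eps - 1) * z `^ (beta - 1) * z.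
  rewrite (_ : beta + eps - 1 = (eps - 1) + (beta - 1) + 1); last by ring.
  by rewrite powRD ?(gt_eqF z0) ?implybT// powRD ?(gt_eqF z0) ?implybT// powRr1 ?ltW.
have := lt0r_neq0 (Gamma_gt0 be_gt0); have := lt0r_neq0 (Gamma_gt0 eps_gt0).
have := lt0r_neq0 (Gamma_gt0 beta_gt0).
move: (Gamma _) (Gamma _) (Gamma _) (_ `^ _) (_ `^ _) => G1 G2 G3 p1 p2 G10 G20 G30.
by field; rewrite G10 G20.
Qed.

Lemma Lambda_L2 (f : R -> R) : f \in Lfun (nu_gamma eps) 2%:E ->
  Lambda beta eps f \in Lfun (nu_gamma (beta + eps)) 2%:E.
Proof.
move=> fL; have mf := Lfun2_measurable fL.
apply: (@conditional_expectation_L2 _ _ _ _ R leb leb joint_pdf (gamma_pdf eps)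
  (gamma_pdf (beta + eps)) (nu_gamma eps)) fL _ _ => //.
- exact: joint_pdf_ge0.
- exact: measurable_joint_pdf.
- exact: gamma_pdf_ge0.
- exact: measurable_gamma_pdf.
- exact: gamma_pdf_ge0.
- exact: measurable_gamma_pdf.
- exact: integral_joint_pdf2.
- exact: integral_joint_pdf1.
- exact: measurable_Lambda.
- by move=> z; exact: Lambda_joint_pdf.
Qed.

(** E(g(X + Y) | X = x). For x <= 0 the quotient is 0 / 0 = 0, consistent with [adj_joint_pdf]. *)
Let adj (g : R -> R) x := (\int[leb]_z (g z * joint_pdf (x, z))) / gamma_pdf eps x.

Let adj_joint_pdf g x : adj g x * gamma_pdf eps x = \int[leb]_z (g z * joint_pdf (x, z)).
Proof.
rewrite /adj; have [x0|x0] := leP x 0.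
  rewrite gamma_pdfE /gamma_w pos_pow_le0// !mul0r mulr0.
  rewrite /Rintegral integral0_eq// => z _; rewrite /joint_pdf /conv_w/=.
  by rewrite pos_pow_le0// !mul0r mulr0.
rewrite mulfVK// gamma_pdfE /gamma_w pos_powE// gt_eqF//.
by rewrite divr_gt0 ?mulr_gt0 ?powR_gt0 ?expR_gt0 ?Gamma_gt0.
Qed.

Let measurable_adj g : measurable_fun setT g -> measurable_fun setT (adj g).
Proof.
move=> mg; apply: measurable_funM.
  apply: (@measurable_Rintegral_param _ _ _ _ R leb
    (fun zx : R * R => g zx.1 * joint_pdf (zx.2, zx.1))).
  apply: measurable_funM; first exact: (measurableT_comp mg).
  by apply: (measurableT_comp measurable_joint_pdf); exact: measurable_fun_pair.
(* On nonnegative reals, 0 included, the inverse is the power -1, which is measurable. *)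
under eq_fun do rewrite -powR_inv1 ?gamma_pdf_ge0//.
by apply: (measurableT_comp (measurable_powR _)); exact: measurable_gamma_pdf.
Qed.

(** With [adj] g as a witness, the function selected by [xget] has the adjoint property, whichever
    one it is. *)
Lemma Lambda_adjP (g : R -> R) : g \in Lfun (nu_gamma (beta + eps)) 2%:E ->
  Lambda_adj beta eps g \in Lfun (nu_gamma eps) 2%:E /\
  forall f, f \in Lfun (nu_gamma eps) 2%:E ->
    L2dot (nu_gamma (beta + eps)) (Lambda beta eps f) g =
    L2dot (nu_gamma eps) f (Lambda_adj beta eps g).
Proof.
move=> gL; have mg := Lfun2_measurable gL.
rewrite /Lambda_adj /L2adjoint; set P := (X in xget _ X).
suff : exists h, P h by move=> /(xgetPex (cst 0)).
have mj' : measurable_fun setT (fun zx : R * R => joint_pdf (zx.2, zx.1)).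
  by apply: (measurableT_comp measurable_joint_pdf); exact: measurable_fun_pair.
exists (adj g); split.
  apply: (@conditional_expectation_L2 _ _ _ _ R leb leb
    (fun zx : R * R => joint_pdf (zx.2, zx.1)) (gamma_pdf (beta + eps))
    (gamma_pdf eps) (nu_gamma (beta + eps))) gL _ _ => //.
  - by move=> zx; exact: joint_pdf_ge0.
  - exact: gamma_pdf_ge0.
  - exact: measurable_gamma_pdf.
  - exact: gamma_pdf_ge0.
  - exact: measurable_gamma_pdf.
  - exact: integral_joint_pdf1.
  - exact: integral_joint_pdf2.
  - exact: measurable_adj.
move=> f fL; have mf := Lfun2_measurable fL.
apply: (@L2dot_conditional_expectation_adj _ _ _ _ R leb leb joint_pdf
  (gamma_pdf eps) (gamma_pdf (beta + eps)) (nu_gamma eps)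
  (nu_gamma (beta + eps)) joint_pdf_ge0 measurable_joint_pdf
  (gamma_pdf_ge0 eps) (measurable_gamma_pdf eps) (fun A _ => nu_gammaE eps A)
  (gamma_pdf_ge0 (beta + eps)) (measurable_gamma_pdf (beta + eps))
  (fun A _ => nu_gammaE (beta + eps) A) integral_joint_pdf2
  integral_joint_pdf1 f _ g _ fL gL (measurable_Lambda mf)
  (fun z => Lambda_joint_pdf z mf) (measurable_adj mg)).
by move=> x; exact: adj_joint_pdf.
Qed.

End Lambda_theory.

(** * Laguerre polynomials *)

Section laguerre_polynomials.
Context {R : realType}.
Implicit Types (gam : R) (n j k : nat) (p q : {poly R}).

Definition poch gam n : R := \prod_(i < n) (gam + i%:R).

Lemma poch0 gam : poch gam 0 = 1. Proof. by rewrite /poch big_ord0. Qed.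

Lemma pochSr gam n : poch gam n.+1 = poch gam n * (gam + n%:R).
Proof. by rewrite /poch big_ord_recr. Qed.

Lemma pochSl gam n : poch gam n.+1 = gam * poch (gam + 1) n.
Proof.
rewrite /poch big_ord_recl addr0; congr (_ * _); apply: eq_bigr => i _.
by rewrite /= /bump/= add1n -natr1; ring.
Qed.

Lemma poch_gt0 gam n : 0 < gam -> 0 < poch gam n.
Proof. by move=> g0; apply: prodr_gt0 => i _; rewrite ltr_pwDl. Qed.

Lemma poch_addn gam k j : poch gam (k + j) = poch gam k * poch (gam + k%:R) j.
Proof.
elim: j => [|j IH]; first by rewrite addn0 poch0 mulr1.
by rewrite addnS !pochSr IH natrD addrA mulrA.
Qed.

Lemma Gamma_addn gam n : 0 < gam -> Gamma (gam + n%:R) = poch gam n * Gamma gam.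
Proof.
move=> g0; elim: n => [|n IH]; first by rewrite addr0 poch0 mul1r.
by rewrite -natr1 addrA GammaS ?ltr_pwDl// IH pochSr; ring.
Qed.

(* The n-th finite difference at 0, up to the sign (-1)^n. *)
Definition findiff n (g : nat -> R) : R :=
  \sum_(k < n.+1) (-1) ^+ k * 'C(n, k)%:R * g k.

Lemma findiffS n g : findiff n.+1 g = findiff n (fun k => g k - g k.+1).
Proof.
rewrite /findiff big_ord_recl/= bin0 expr0 mulr1 mul1r.
under eq_bigr do rewrite /bump/= add1n binS natrD mulrDr mulrDl.
rewrite big_split/= big_ord_recr/= bin_small// mulr0 mul0r addr0.
under [RHS]eq_bigr do rewrite mulrBr.
rewrite sumrB addrA; congr (_ + _).
  rewrite [RHS]big_ord_recl/= bin0 expr0 mulr1 mul1r; congr (_ + _).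
rewrite -sumrN; apply: eq_bigr => i _.
by rewrite exprS; ring.
Qed.

(** In k this rising factorial is a polynomial of degree j, and each difference lowers the degree:
    (x)_(j+1) - (x+1)_(j+1) = -(j+1) (x+1)_j. Only j = n leaves a nonzero constant. *)
Lemma findiff_poch gam n j : (j <= n)%N ->
  findiff n (fun k => poch (gam + k%:R) j) = ((-1) ^+ n * n`!%:R) *+ (j == n).
Proof.
elim: n j gam => [|n IH] j gam.
  rewrite leqn0 => /eqP ->; rewrite /findiff big_ord_recr big_ord0/=.
  by rewrite bin0 poch0 !mulr1 expr0 add0r.
case: j => [|j] jn; rewrite findiffS.
  by rewrite /findiff big1// => i _; rewrite !poch0 subrr mulr0.
transitivity (- j.+1%:R * findiff n (fun k => poch (gam + 1 + k%:R) j)).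
  rewrite /findiff mulr_sumr; apply: eq_bigr => i _.
  rewrite pochSl -natr1 pochSr -natr1.
  have -> : gam + (i%:R + 1) = gam + 1 + i%:R by ring.
  have -> : gam + i%:R + 1 = gam + 1 + i%:R by ring.
  ring.
rewrite IH// eqSS; case: eqP => [->|_]; last by rewrite !mulr0n mulr0.
by rewrite !mulr1n factS natrM exprS; ring.
Qed.

(* The integral of [p] against [nu_gamma gam]; see [L2dot_horner]. *)
Definition moment gam p : R := \sum_(i < size p) p`_i * poch gam i.

Lemma moment_wide gam p N : (size p <= N)%N ->
  moment gam p = \sum_(i < N) p`_i * poch gam i.
Proof.
move=> pN; rewrite /moment (big_ord_widen N (fun i => p`_i * poch gam i) pN).
rewrite big_mkcond/=; apply: eq_bigr => i _; case: ltnP => // ip.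
by rewrite nth_default ?mul0r.
Qed.

Lemma moment_is_linear gam : linear (moment gam).
Proof.
move=> a p q; pose N := maxn (size p) (size q).
rewrite !(@moment_wide _ _ N) ?leq_maxl ?leq_maxr//; last first.
  rewrite (leq_trans (size_polyD _ _))// geq_max leq_maxr andbT.
  by rewrite (leq_trans (size_scale_leq _ _))// leq_maxl.
rewrite /= scaler_sumr -big_split/=; apply: eq_bigr => i _.
by rewrite coefD coefZ /GRing.scale/= mulrDl mulrA.
Qed.

HB.instance Definition _ gam := GRing.isLinear.Build R {poly R} R *%R
  (moment gam) (moment_is_linear gam).

Lemma moment_Xn gam n : moment gam 'X^n = poch gam n.
Proof.
rewrite (@moment_wide _ _ n.+1) ?size_polyXn// big_ord_recr/= coefXn eqxx mul1r.
by rewrite big1 ?add0r// => i _; rewrite coefXn ltn_eqF ?mul0r.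
Qed.

Lemma momentM gam p q N : (size p <= N)%N ->
  moment gam (p * q) = \sum_(i < N) p`_i * moment gam ('X^i * q).
Proof.
move=> pN; have -> : p = \sum_(i < N) p`_i *: 'X^i.
  rewrite -poly_def; apply/polyP => i; rewrite coef_poly; case: ltnP => // Ni.
  by rewrite nth_default// (leq_trans pN).
rewrite mulr_suml linear_sum/=; apply: eq_bigr => i _.
rewrite -scalerAl linearZ/=; congr (_ * _).
rewrite coef_sum (bigD1 i)//= coefZ coefXn eqxx mulr1 big1 ?addr0// => j ji.
by rewrite coefZ coefXn eq_sym (negbTE (_ : val j != val i)) ?mulr0.
Qed.

(* Normalised to be 1 at 0. The k-th coefficient is chosen so that the moment of
   lag * x^j is the n-th finite difference of a polynomial of degree j, which
   gives orthogonality. *)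
Definition lag gam n : {poly R} :=
  \poly_(k < n.+1) ((-1) ^+ k * 'C(n, k)%:R / poch gam k).

Lemma size_lag_leq gam n : (size (lag gam n) <= n.+1)%N.
Proof. exact: size_poly. Qed.

Lemma coef_lag gam n k : (lag gam n)`_k = (-1) ^+ k * 'C(n, k)%:R / poch gam k.
Proof.
rewrite coef_poly; case: ltnP => // nk.
by rewrite bin_small// mulr0 mul0r.
Qed.

(** In (gam)_(k+j) = (gam)_k (gam+k)_j the first factor cancels the denominator of the k-th
    coefficient. *)
Lemma moment_lag_Xn gam n j : 0 < gam -> (j <= n)%N ->
  moment gam (lag gam n * 'X^j) = ((-1) ^+ n * n`!%:R) *+ (j == n).
Proof.
move=> g0 jn; rewrite (momentM _ _ (size_lag_leq gam n)) -(findiff_poch gam jn).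
apply: eq_bigr => k _; rewrite -exprD moment_Xn coef_lag poch_addn.
by field; rewrite gt_eqF ?poch_gt0.
Qed.

Definition lag_norm2 gam n : R := n`!%:R / poch gam n.

Lemma lag_norm2_gt0 gam n : 0 < gam -> 0 < lag_norm2 gam n.
Proof. by move=> g0; rewrite divr_gt0 ?poch_gt0 ?ltr0n ?fact_gt0. Qed.

(** Expand the factor of lower degree in powers of x: only a power n of x can contribute, and the
    two signs (-1)^n cancel. *)
Lemma moment_lagM gam m n : 0 < gam ->
  moment gam (lag gam m * lag gam n) = lag_norm2 gam n *+ (m == n).
Proof.
move=> g0; wlog mn : m n / (m <= n)%N => [H|].
  have [/H//|/ltnW/H] := leqP m n.
  by rewrite mulrC eq_sym => ->; case: eqP => [->//|_]; rewrite !mulr0n.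
rewrite (momentM _ _ (size_lag_leq gam m)) big_ord_recr/= big1 ?add0r => [|i _].
  rewrite ['X^m * _]mulrC moment_lag_Xn// coef_lag; case: eqP => [->|_];
    last by rewrite !mulr0n mulr0.
  rewrite !mulr1n binn /lag_norm2.
  have -> : (-1) ^+ n * 1 / poch gam n * ((-1) ^+ n * n`!%:R) =
     ((-1) ^+ n * (-1) ^+ n) * (n`!%:R / poch gam n) by ring.
  by rewrite -exprMn mulrNN mulr1 expr1n mul1r.
have im : (i < n)%N by exact: leq_trans (ltn_ord i) mn.
by rewrite ['X^i * _]mulrC moment_lag_Xn ?(ltnW im)// (ltn_eqF im) mulr0n mulr0.
Qed.

Definition Lpoly gam p : {poly R} := 'X * p^`()^`() + (gam%:P - 'X) * p^`().

Lemma coef_Lpoly gam p k :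
  (Lpoly gam p)`_k = k.+1%:R * (gam + k%:R) * p`_k.+1 - k%:R * p`_k.
Proof.
rewrite /Lpoly mulrBl coefD coefB !coefXM coefCM !coef_deriv.
have natl (x : R) j : x *+ j = j%:R * x by rewrite mulr_natl.
by case: k => [|k] /=; rewrite !(natl p`_ _) ?(natl (_ * p`_ _)) -?natr1; ring.
Qed.

(** [Lpoly] sends x^k into the span of x^k and x^(k-1), so comparing coefficients reduces to (k+1)
    C(n, k+1) = (n-k) C(n, k). *)
Lemma Lpoly_lag gam n : 0 < gam -> Lpoly gam (lag gam n) = - n%:R *: lag gam n.
Proof.
move=> g0; apply/polyP => k; rewrite coefZ coef_Lpoly !coef_lag pochSr.
have pk : poch gam k != 0 by rewrite gt_eqF ?poch_gt0.
have gk : gam + k%:R != 0 by rewrite gt_eqF// ltr_pwDl.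
have binE : k.+1%:R * 'C(n, k.+1)%:R = (n%:R - k%:R) * 'C(n, k)%:R :> R.
  rewrite -natrM mul_bin_left natrM; have [kn|nk] := leqP k n; first by rewrite natrB.
  by rewrite bin_small// !mulr0.
transitivity (- ((-1) ^+ k / poch gam k * (k.+1%:R * 'C(n, k.+1)%:R)) -
   k%:R * ((-1) ^+ k * 'C(n, k)%:R / poch gam k)).
  by rewrite exprS; field; rewrite pk gk.
by rewrite binE; field.
Qed.

(* The integrand is 1/w (x w p)' for the weight w = x^(gam - 1) e^(-x). *)
Lemma moment_Lpoly0 gam p : moment gam ('X * p^`() + (gam%:P - 'X) * p) = 0.
Proof.
rewrite (_ : _ + _ = \sum_(i < size p) p`_i *:
    ('X * ('X^i)^`() + (gam%:P - 'X) * 'X^i)); last first.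
  rewrite -[in LHS](coefK p) poly_def raddf_sum/= !mulr_sumr -big_split/=.
  by apply: eq_bigr => i _; rewrite derivZ -!scalerAr scalerDr.
rewrite linear_sum/= big1// => i _; rewrite linearZ/=.
rewrite (_ : 'X * _ + _ = (i%:R + gam) *: 'X^i - 'X^(i.+1)).
  by rewrite linearB linearZ/= !moment_Xn pochSr; ring.
rewrite derivXn mulrBl -exprS addrA; congr (_ - _).
rewrite mul_polyC scalerDl; congr (_ + _).
case: (nat_of_ord i) => [|k]; first by rewrite mulr0n mulr0 scale0r.
by rewrite mulrnAr -exprS scaler_nat.
Qed.

(** Integration by parts: the two sides differ by the integral of the derivative of x w p' q, with w
    the weight. The right side is the Dirichlet form, whose symmetry makes the operator
    symmetric. *)
Lemma moment_LpolyM gam p q :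
  moment gam (Lpoly gam p * q) = - moment gam ('X * (p^`() * q^`())).
Proof.
apply/eqP; rewrite -subr_eq0 opprK -linearD/=; apply/eqP.
rewrite -[RHS](moment_Lpoly0 gam (p^`() * q)); congr (moment _ _).
by rewrite /Lpoly derivM; ring.
Qed.

Lemma moment_Lpoly_sym gam p q :
  moment gam (Lpoly gam p * q) = moment gam (p * Lpoly gam q).
Proof. by rewrite [p * _]mulrC !moment_LpolyM [q^`() * _]mulrC. Qed.

(** The n-th Laguerre polynomial has exact degree n, so leading terms can be removed one at a
    time. *)
Lemma lag_span gam n p : 0 < gam -> (size p <= n)%N ->
  exists c : nat -> R, p = \sum_(i < n) c i *: lag gam i.
Proof.
move=> g0; elim: n p => [|n IH] p.
  by rewrite size_poly_leq0 => /eqP ->; exists (fun=> 0); rewrite big_ord0.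
move=> pn; have ln : (lag gam n)`_n != 0.
  rewrite coef_lag binn mulr1 mulf_neq0 ?signr_eq0//.
  by rewrite invr_eq0 gt_eqF ?poch_gt0.
set a := p`_n / (lag gam n)`_n.
have [|c Hc] := IH (p - a *: lag gam n).
  apply/leq_sizeP => j nj; rewrite coefB coefZ.
  case: (ltngtP n j) nj => // [nj|<-] _; last by rewrite /a mulfVK// subrr.
  rewrite nth_default ?(leq_trans pn)// coef_lag bin_small// mulr0 mul0r mulr0.
  by rewrite subrr.
exists (fun i => if i == n then a else c i).
rewrite big_ord_recr/= eqxx (eq_bigr (fun i : 'I_n => c i *: lag gam i)).
  by rewrite -Hc subrK.
by move=> i _; rewrite ltn_eqF.
Qed.

End laguerre_polynomials.

(** * Density of polynomials *)

Section L2_domination.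
Context d (T : measurableType d) (R : realType).
Variable mu : {measure set T -> \bar R}.
Implicit Types f g : T -> R.
Local Notation L2 := (Lfun mu 2%:E).
Local Notation dot := (L2dot mu).

Lemma Lfun2_dom f g : measurable_fun setT f -> g \in L2 ->
  {ae mu, forall x, `|f x| <= `|g x|} -> f \in L2.
Proof.
move=> mf /Lfun2P[mg gL] fg; apply/Lfun2P; split => //.
apply: le_lt_trans gL; apply: ae_ge0_le_integral => //.
- by move=> x _; rewrite lee_fin sqr_ge0.
- by apply/measurable_EFinP; exact: measurable_funX.
- by move=> x _; rewrite lee_fin sqr_ge0.
- by apply/measurable_EFinP; exact: measurable_funX.
apply: filterS fg => x fgx _; rewrite lee_fin.
by rewrite -(real_normK (num_real (f x))) -(real_normK (num_real (g x))) lerXn2r// nnegrE.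
Qed.

Lemma L2_dominated_cvg (u : nat -> T -> R) f g :
  (forall n, measurable_fun setT (u n)) -> measurable_fun setT f -> g \in L2 ->
  {ae mu, forall x, u n x @[n --> \oo] --> f x} ->
  {ae mu, forall x, forall n, `|u n x| <= `|g x|} ->
  f \in L2 /\ (forall n, u n \in L2) /\
  dot (fun x => u n x - f x) (fun x => u n x - f x) @[n --> \oo] --> 0.
Proof.
move=> mu_ mf gL uf ug.
have fg : {ae mu, forall x, `|f x| <= `|g x|}.
  apply: filterS2 uf ug => x ufx ugx.
  have cx : `|u n x| @[n --> \oo] --> `|f x| by exact: cvg_norm.
  rewrite -(cvg_lim (@Rhausdorff R) cx); apply: limr_le; last exact: nearW.
  by apply/cvg_ex; exists `|f x|.
have fL := Lfun2_dom mf gL fg.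
have uL n : u n \in L2.
  by apply: (Lfun2_dom (mu_ n) gL); apply: filterS ug => x /(_ n).
split => //; split => //.
have mg := Lfun2_measurable gL.
(* The limit is dominated by |g| as well, so |u n - f| <= 2 |g|, and 4 g^2 is the majorant. *)
have ig : mu.-integrable setT (fun x => (4 * (g x * g x))%:E).
  have := integrableZl measurableT 4 (Lfun2_mul_integrable gL gL).
  by apply: eq_integrable => // x _; rewrite /= EFinM.
have := @dominated_convergence _ _ _ mu setT measurableT
  (fun n x => ((u n x - f x) * (u n x - f x))%:E) (fun=> 0%E)
  (fun x => (4 * (g x * g x))%:E).
case.
- move=> n; apply/measurable_EFinP; apply: measurable_funM; exact: measurable_funB.
- exact: measurable_cst.
- apply: filterS uf => x ufx _.
  have H : u n x - f x @[n --> \oo] --> 0.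
    by rewrite -(subrr (f x)); apply: cvgB => //; exact: cvg_cst.
  apply: cvg_EFin; first exact: nearW.
  by rewrite -(mulr0 0); apply: (cvgM H H).
- exact: ig.
- apply: filterS2 fg ug => x fgx ugx n _.
  rewrite abse_EFin lee_fin ger0_norm -?expr2 ?sqr_ge0//.
  rewrite -(real_normK (num_real (u n x - f x))) -(real_normK (num_real (g x))).
  have H : `|u n x - f x| <= 2 * `|g x|.
    by rewrite (le_trans (ler_normB _ _))// mulr_natl mulr2n lerD.
  have -> : 4 * `|g x| ^+ 2 = (2 * `|g x|) ^+ 2 by ring.
  by rewrite lerXn2r// nnegrE ?mulr_ge0.
move=> _ _; rewrite integral0 => H.
exact: (fine_cvg H).
Qed.

End L2_domination.

Section polynomial_density.
Context {R : realType}.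
Variables (gam : R) (gam_gt0 : 0 < gam).
Local Notation leb := (@lebesgue_measure R).
Local Notation nu := (nu_gamma gam).
Local Notation L2 := (Lfun (nu_gamma gam) 2%:E).
Local Notation dot := (L2dot (nu_gamma gam)).
Implicit Types (f g w : R -> R) (p q : {poly R}).

(** The exceptional point a is for the approximation of the indicator of ]a, +oo[, whose
    approximants tend to 1/e at a. *)
Lemma ae_nu_gamma (a : R) (P : R -> Prop) :
  (forall x, 0 < x -> x != a -> P x) -> {ae nu, forall x, P x}.
Proof.
move=> H; exists (`]-oo, 0] `|` [set a]); split.
- by apply: measurableU => //; exact: measurable_set1.
- apply: null_set_setU => //; rewrite ?nu_gammaE.
  + apply: integral0_eq => x /=; rewrite in_itv/= => x0.
    by rewrite gamma_pdfE /gamma_w pos_pow_le0// !mul0r.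
  + exact: integral_set1.
- move=> x /= nP; rewrite in_itv/=.
  have [x0|x0] := leP x 0; first by left.
  by have [->|xa] := eqVneq x a; [right|have := H x x0 xa].
Qed.

Lemma integral_nu_gamma f : measurable_fun setT f ->
  (\int[nu]_x (f x)%:E = \int[leb]_x (f x * gamma_pdf gam x)%:E)%E.
Proof.
exact: (@integral_density _ (measurableTypeR R) R leb nu (gamma_pdf gam)
  (gamma_pdf_ge0 gam) (measurable_gamma_pdf gam) (fun A _ => nu_gammaE gam A)).
Qed.

Lemma integral_pow_nu_gamma n : (\int[nu]_x (x ^+ n)%:E = (poch gam n)%:E)%E.
Proof.
rewrite integral_nu_gamma; last exact: measurable_funX.
rewrite (eq_integral (fun x : measurableTypeR R =>
  ((Gamma gam)^-1)%:E * (gamma_w (gam + n%:R) x)%:E)%E).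
  rewrite ge0_integralZl//; last 3 first.
  - exact: measurable_EFin_gamma_w.
  - by move=> x _; rewrite lee_fin gamma_w_ge0.
  - by rewrite lee_fin invr_ge0 Gamma_ge0.
  rewrite -/(EGamma _) EGammaE ?ltr_pwDl// Gamma_addn// -EFinM; congr EFin.
  by rewrite mulrCA mulVf ?mulr1// gt_eqF ?Gamma_gt0.
move=> x _; rewrite gamma_pdfE /gamma_w -pos_pow_mulXn -EFinM; congr EFin; ring.
Qed.

(* The remaining e^(x / 4) dominates the Taylor polynomials of e^(-s x) for
   s <= 1/4, with room for a polynomial factor. *)
Lemma pow_exp_L2 n : (fun x => x ^+ n * expR (x / 4)) \in L2.
Proof.
have mexp : measurable_fun setT (fun x : R => expR (x / 4)).
  by apply: measurableT_comp; [exact: measurable_expR|exact: measurable_funM].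
apply/Lfun2P; split; first by apply: measurable_funM => //; exact: measurable_funX.
rewrite integral_nu_gamma; last first.
  by apply: measurable_funX; apply: measurable_funM => //; exact: measurable_funX.
set a := gam + (n + n)%:R.
rewrite (eq_integral (fun x : measurableTypeR R =>
  ((Gamma gam)^-1)%:E * (pos_pow a x * expR (- (x / 2)))%:E)%E); last first.
  move=> x _; rewrite gamma_pdfE /gamma_w -pos_pow_mulXn -EFinM; congr EFin.
  have -> : expR (- (x / 2)) = expR (x / 4) ^+ 2 * expR (- x).
    by rewrite -expRM_natl -expRD; congr expR; field.
  by rewrite exprD; ring.
have mg : measurable_fun setT (fun x : R => (pos_pow a x * expR (- (x / 2)))%:E).
  apply/measurable_EFinP/measurable_funM; first exact: measurable_pos_pow.
  apply: measurableT_comp; first exact: measurable_expR.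
  by apply: measurableT_comp => //; exact: measurable_funM.
have g0 x : (0 <= (pos_pow a x * expR (- (x / 2)))%:E)%E.
  by rewrite lee_fin mulr_ge0 ?pos_pow_ge0 ?expR_ge0.
rewrite ge0_integralZl//; last by rewrite lee_fin invr_ge0 Gamma_ge0.
rewrite (@ge0_integral_affine _ 2 0)//.
rewrite (eq_integral (fun x : measurableTypeR R =>
  (2 `^ (a - 1))%:E * (gamma_w a x)%:E)%E); last first.
  move=> x _; rewrite addr0 pos_powM// /gamma_w -EFinM -mulrA;
    congr (_ * (_ * expR _))%:E.
  by field.
rewrite ge0_integralZl//; last 2 first.
- exact: measurable_EFin_gamma_w.
- by move=> x _; rewrite lee_fin gamma_w_ge0.
by rewrite -/(EGamma a) EGammaE ?ltr_pwDl// -!EFinM ltry.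
Qed.

Lemma measurable_horner p : measurable_fun setT (horner p).
Proof.
rewrite (_ : horner p = fun x => \sum_(i < size p) p`_i * x ^+ i); last first.
  by apply/funext => x; rewrite horner_coef.
apply: measurable_sum => i; apply: measurable_funM => //; exact: measurable_funX.
Qed.

Lemma horner_exp_L2 p : (fun x => p.[x] * expR (x / 4)) \in L2.
Proof.
rewrite (_ : (fun x => _) =
    fun x => \sum_(i < size p) p`_i * (x ^+ i * expR (x / 4))); last first.
  apply/funext => x; rewrite horner_coef mulr_suml.
  by apply: eq_bigr => i _; rewrite mulrA.
apply: (@Lfun2_sum _ (measurableTypeR R) R nu _
  (fun i x => p`_i * (x ^+ i * expR (x / 4)))) => i _.
by apply: Lfun2Z; exact: pow_exp_L2.
Qed.

Lemma horner_L2 p : horner p \in L2.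
Proof.
apply: (Lfun2_dom _ (horner_exp_L2 p)); first exact: measurable_horner.
apply: (@ae_nu_gamma 0) => x x0 _; rewrite normrM ler_peMr//.
by rewrite ger0_norm ?expR_ge0// -expR0 ler_expR divr_ge0// ltW.
Qed.

Definition poly_closure f := f \in L2 /\ forall e, 0 < e -> exists p,
  dot (fun x => f x - p.[x]) (fun x => f x - p.[x]) < e.

Lemma poly_closure_horner p : poly_closure (horner p).
Proof.
split; first exact: horner_L2.
move=> e e0; exists p; rewrite (_ : (fun x => _) = fun=> 0) ?L2dot0l//.
by apply/funext => x; rewrite subrr.
Qed.

Lemma poly_closure_approx f : f \in L2 ->
  (forall e, 0 < e -> exists2 g, poly_closure g &
    dot (fun x => f x - g x) (fun x => f x - g x) < e) -> poly_closure f.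
Proof.
move=> fL H; split=> // e e0.
(* By [L2dot_add_le] squared distances add up with a factor 2, hence e / 4 for each of the two. *)
have [|g [gL Hg] fg] := H (e / 4); first by rewrite divr_gt0.
have [|p gp] := Hg (e / 4); first by rewrite divr_gt0.
exists p.
have -> : (fun x => f x - p.[x]) = (fun x => (f x - g x) + (g x - p.[x])).
  by apply/funext => x; ring.
apply: le_lt_trans (L2dot_add_le _ _) _.
- exact: Lfun2B.
- by apply: Lfun2B => //; exact: horner_L2.
- by lra.
Qed.

Lemma poly_closureD f g : poly_closure f -> poly_closure g ->
  poly_closure (fun x => f x + g x).
Proof.
move=> [fL Hf] [gL Hg]; split; first exact: Lfun2D.
move=> e e0; have [|p fp] := Hf (e / 4); first by rewrite divr_gt0.
have [|q gq] := Hg (e / 4); first by rewrite divr_gt0.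
exists (p + q).
have -> : (fun x => f x + g x - (p + q).[x]) =
    (fun x => (f x - p.[x]) + (g x - q.[x])).
  by apply/funext => x; rewrite hornerD; ring.
apply: le_lt_trans (L2dot_add_le _ _) _.
- by apply: Lfun2B => //; exact: horner_L2.
- by apply: Lfun2B => //; exact: horner_L2.
- by lra.
Qed.

Lemma poly_closureZ a f : poly_closure f -> poly_closure (fun x => a * f x).
Proof.
(* The tolerance is divided by a^2 + 1 and not a^2, so that a = 0 needs no separate case. *)
move=> [fL Hf]; split; first exact: Lfun2Z.
move=> e e0; have [|p fp] := Hf (e / (a ^+ 2 + 1)).
  by rewrite divr_gt0// ltr_wpDl// sqr_ge0.
exists (a *: p).
have fpL : (fun x => f x - p.[x]) \in L2 by apply: Lfun2B => //; exact: horner_L2.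
have -> : (fun x => a * f x - (a *: p).[x]) = (fun x => a * (f x - p.[x])).
  by apply/funext => x; rewrite hornerZ; ring.
rewrite L2dotZl//; last exact: Lfun2Z.
rewrite L2dotC L2dotZl//.
have a1 : 0 < a ^+ 2 + 1 by rewrite ltr_wpDl// sqr_ge0.
move: fp; rewrite ltr_pdivlMr// => H; apply: le_lt_trans H.
rewrite mulrDr mulr1 mulrA -expr2 mulrC lerDl; exact: L2dot_ge0.
Qed.

Lemma poly_closure_dominated (u : nat -> R -> R) f g a :
  (forall n, poly_closure (u n)) -> measurable_fun setT f -> g \in L2 ->
  (forall x, 0 < x -> x != a -> u n x @[n --> \oo] --> f x) ->
  (forall x, 0 < x -> forall n, `|u n x| <= `|g x|) -> poly_closure f.
Proof.
move=> uc mf gL uf ug.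
have mu_ n : measurable_fun setT (u n) by case: (uc n) => /Lfun2_measurable.
have [fL [uL H]] := @L2_dominated_cvg _ (measurableTypeR R) R nu u f g mu_ mf gL
  (ae_nu_gamma uf) (@ae_nu_gamma 0 _ (fun x x0 _ => ug x x0)).
apply: poly_closure_approx => // e e0.
move/cvgrPdist_lt : H => /(_ _ e0) [N _ /(_ N (leqnn _))]/=.
rewrite sub0r normrN ger0_norm ?L2dot_ge0// => H.
exists (u N) => //; apply: le_lt_trans H.
by rewrite le_eqVlt; apply/orP; left; apply/eqP; apply: eq_Rintegral => x _; ring.
Qed.

(** The bound is asked only on the support of the measure, since e^(-s x) is unbounded for x < 0.
    Quantifying over all q is what yields stability under products. *)
Definition poly_multiplier w := [/\ measurable_fun setT w,
  exists C, forall x, 0 < x -> `|w x| <= C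
  & forall q, poly_closure (fun x => q.[x] * w x)].

Lemma poly_multiplier_cst a : poly_multiplier (fun=> a).
Proof.
split => //; first by exists `|a|.
move=> q; have := poly_closure_horner (a *: q); congr poly_closure.
by apply/funext => x; rewrite hornerZ mulrC.
Qed.

Lemma poly_multiplierD w1 w2 : poly_multiplier w1 -> poly_multiplier w2 ->
  poly_multiplier (fun x => w1 x + w2 x).
Proof.
move=> [m1 [C1 b1] c1] [m2 [C2 b2] c2]; split; first exact: measurable_funD.
  by exists (C1 + C2) => x x0; rewrite (le_trans (ler_normD _ _))// lerD ?b1 ?b2.
move=> q; have := poly_closureD (c1 q) (c2 q); congr poly_closure.
by apply/funext => x; ring.
Qed.

Lemma poly_multiplierZ a w : poly_multiplier w -> poly_multiplier (fun x => a * w x).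
Proof.
move=> [m1 [C1 b1] c1]; split; first exact: measurable_funM.
  by exists (`|a| * C1) => x x0; rewrite normrM ler_wpM2l ?b1.
move=> q; have := poly_closureZ a (c1 q); congr poly_closure.
by apply/funext => x; ring.
Qed.

(** Approximate q w1 by a polynomial p. Multiplying by the bounded w2 enlarges the error by at most
    a constant factor, and p w2 is in the closure by assumption on w2. *)
Lemma poly_multiplierM w1 w2 : poly_multiplier w1 -> poly_multiplier w2 ->
  poly_multiplier (fun x => w1 x * w2 x).
Proof.
move=> [m1 [C1 b1] c1] [m2 [C2 b2] c2]; split; first exact: measurable_funM.
  by exists (C1 * C2) => x x0; rewrite normrM ler_pM ?b1 ?b2.
move=> q.
have C20 : 0 <= C2 by apply: le_trans (b2 1 ltr01).
have bdd f : f \in L2 -> (fun x => f x * w2 x) \in L2.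
  move=> fL; have mf := Lfun2_measurable fL.
  apply: (@Lfun2_dom _ (measurableTypeR R) R nu _ (fun x => C2 * f x)).
  - exact: measurable_funM.
  - exact: Lfun2Z.
  - apply: (@ae_nu_gamma 0) => x x0 _.
    by rewrite !normrM mulrC (ger0_norm C20) ler_wpM2r// b2.
apply: poly_closure_approx.
  rewrite (_ : (fun x => _) = (fun x => q.[x] * w1 x * w2 x)).
    by apply: bdd; case: (c1 q).
  by apply/funext => x; rewrite mulrA.
move=> e e0; have [qL Hq] := c1 q.
have C21 : 0 < C2 ^+ 2 + 1 by rewrite ltr_wpDl// sqr_ge0.
have [|p qp] := Hq (e / (C2 ^+ 2 + 1)); first by rewrite divr_gt0.
exists (fun x => p.[x] * w2 x); first exact: c2.
set h := (fun x => q.[x] * w1 x - p.[x]) in qp.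
have hL : h \in L2 by apply: (Lfun2B qL); exact: horner_L2.
move: qp; rewrite ltr_pdivlMr// => qp; apply: le_lt_trans qp.
apply: (@le_trans _ _ (C2 ^+ 2 * dot h h)); last first.
  by rewrite mulrC ler_wpM2l ?L2dot_ge0// lerDl.
have hwL : (fun x => h x * w2 x) \in L2 by exact: bdd.
have -> : (fun x => q.[x] * (w1 x * w2 x) - p.[x] * w2 x) = (fun x => h x * w2 x).
  by apply/funext => x; rewrite /h; ring.
rewrite -lee_fin EFinM !EFin_L2dot// -ge0_integralZl//; last 3 first.
- by apply/measurable_EFinP/measurable_funX; exact: Lfun2_measurable hL.
- by move=> x _; rewrite lee_fin sqr_ge0.
- by rewrite lee_fin sqr_ge0.
apply: ae_ge0_le_integral => //.
- by move=> x _; rewrite lee_fin sqr_ge0.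
- by apply/measurable_EFinP/measurable_funX; exact: Lfun2_measurable hwL.
- by move=> x _; rewrite mule_ge0 ?lee_fin ?sqr_ge0.
- apply/measurable_EFinP/measurable_funM => //.
  by apply/measurable_funX; exact: Lfun2_measurable hL.
apply: (@ae_nu_gamma 0) => x x0 _ _; rewrite -EFinM lee_fin exprMn mulrC.
rewrite ler_wpM2r ?sqr_ge0// -(real_normK (num_real (w2 x))).
by rewrite lerXn2r ?nnegrE// b2.
Qed.

Lemma poly_multiplierX w n : poly_multiplier w -> poly_multiplier (fun x => w x ^+ n).
Proof.
move=> ww; elim: n => [|n IH]; first exact: poly_multiplier_cst.
by under eq_fun do rewrite exprS; exact: poly_multiplierM.
Qed.

Lemma poly_multiplier_cvg (u : nat -> R -> R) w C a :
  (forall n, poly_multiplier (u n)) -> measurable_fun setT w ->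
  (forall x, 0 < x -> forall n, `|u n x| <= C) ->
  (forall x, 0 < x -> `|w x| <= C) ->
  (forall x, 0 < x -> x != a -> u n x @[n --> \oo] --> w x) ->
  poly_multiplier w.
Proof.
move=> uw mw uC wC uw_cvg; split => //; first by exists C.
move=> q; apply: (@poly_closure_dominated (fun n x => q.[x] * u n x) _
  (fun x => C * q.[x]) a).
- by move=> n; case: (uw n).
- by apply: measurable_funM => //; exact: measurable_horner.
- by apply: Lfun2Z; exact: horner_L2.
- by move=> x x0 xa; apply: cvgMr; exact: uw_cvg.
- move=> x x0 n; have C0 : 0 <= C by apply: le_trans (uC x x0 0%N).
  by rewrite !normrM (ger0_norm C0) mulrC ler_wpM2r ?uC.
Qed.

Lemma series_exp_coeff_horner (s x : R) n :
  (\sum_(k < n) ((- s) ^+ k / k`!%:R) *: 'X^k).[x] = series (exp_coeff (- (s * x))) n.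
Proof.
rewrite horner_sum /series/= big_mkord; apply: eq_bigr => k _.
by rewrite hornerZ hornerXn /exp_coeff/= -mulNr exprMn; ring.
Qed.

Lemma series_exp_coeff_le (y : R) n : `|series (exp_coeff y) n| <= expR `|y|.
Proof.
apply: (@le_trans _ _ (series (exp_coeff `|y|) n)).
  rewrite /series/= !big_mkord (le_trans (ler_norm_sum _ _ _))//.
  apply: ler_sum => k _; rewrite /exp_coeff/= normrM normrX.
  by rewrite (@ger0_norm _ (_^-1)) ?invr_ge0.
apply: (@nondecreasing_cvgn_le _ (series (exp_coeff `|y|))).
  apply: (@nondecreasing_series _ _ xpredT) => k _ _; exact: exp_coeff_ge0.
exact: is_cvg_series_exp_coeff.
Qed.

(** q times the Taylor sums of e^(-s x) are polynomials, bounded for x > 0 by |q(x)| e^(s x) <=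
    |q(x)| e^(x / 4), which is in L^2. *)
Lemma poly_multiplier_exp_small (s : R) : 0 <= s <= 4^-1 ->
  poly_multiplier (fun x => expR (- (s * x))).
Proof.
move=> /andP[s0 s4].
have ms : measurable_fun setT (fun x : R => expR (- (s * x))).
  apply: measurableT_comp; first exact: measurable_expR.
  by apply: measurableT_comp => //; exact: measurable_funM.
split => //.
  exists 1 => x x0; rewrite ger0_norm ?expR_ge0// expR_le1 oppr_le0 mulr_ge0//.
  exact: ltW.
move=> q; pose P n : {poly R} := \sum_(k < n) ((- s) ^+ k / k`!%:R) *: 'X^k.
apply: (@poly_closure_dominated (fun n x => (q * P n).[x]) _ _ 0 _ _
  (horner_exp_L2 q)).
- by move=> n; exact: poly_closure_horner.
- by apply: measurable_funM => //; exact: measurable_horner.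
- move=> x x0 _; under eq_fun do rewrite hornerM series_exp_coeff_horner.
  by apply: cvgMr; exact: (is_cvg_series_exp_coeff (- (s * x))).
- move=> x x0 n; rewrite hornerM series_exp_coeff_horner !normrM.
  rewrite ler_wpM2l// (le_trans (series_exp_coeff_le _ _))//.
  rewrite (ger0_norm (expR_ge0 _)) ler_expR normrN ger0_norm ?mulr_ge0 ?(ltW x0)//.
  by rewrite mulrC ler_wpM2l// ltW.
Qed.

Lemma poly_multiplier_exp (s : R) : 0 <= s ->
  poly_multiplier (fun x => expR (- (s * x))).
Proof.
(* Since n > 4 s, the rate s / n is small enough, and the n-th power restores s. *)
move=> s0; pose n := (Num.truncn (4 * s)).+1.
have n0 : 0 < n%:R :> R by rewrite ltr0n.
have : poly_multiplier (fun x => expR (- ((s / n%:R) * x)) ^+ n).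
  apply/poly_multiplierX/poly_multiplier_exp_small; rewrite divr_ge0//=.
  rewrite ler_pdivrMr// mulrC ler_pdivlMr// mulrC; exact/ltW/truncnS_gt.
congr poly_multiplier; apply/funext => x; rewrite -expRM_natl; congr expR.
by field; rewrite gt_eqF.
Qed.

Lemma bernoulli_ineq (t : R) N : 0 <= t <= 1 -> 1 - N%:R * t <= (1 - t) ^+ N.
Proof.
move=> /andP[t0 t1]; elim: N => [|N IH]; first by rewrite mul0r subr0.
rewrite exprS -natr1 (@le_trans _ _ ((1 - t) * (1 - N%:R * t)))//.
  (* The difference of the two sides is N t^2. *)
  have := mulr_ge0 (ler0n R N) (sqr_ge0 t); rewrite -subr_ge0 => H.
  by rewrite -subr_ge0; apply: le_trans H _; rewrite le_eqVlt; apply/orP; left;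
    apply/eqP; ring.
by rewrite ler_wpM2l// subr_ge0.
Qed.

(* With y = e^(-s x) this turns exponentials into the indicator of a ray. *)
Lemma cvg_pow_step (y : R) : 0 < y <= 1 -> y != 2^-1 ->
  (1 - y ^+ n) ^+ (2 ^ n) @[n --> \oo] --> ((y < 2^-1)%R%:R : R).
Proof.
move=> /andP[y0 y1] y2.
have yn n : 0 <= y ^+ n <= 1 by rewrite exprn_ge0 ?(ltW y0)//= exprn_ile1// ltW.
have [ylt|ygt] := ltP y 2^-1.
  (* The lower bound is Bernoulli's inequality with t = y^n and exponent 2^n. *)
  apply: (@squeeze_cvgr _ _ _ _ (fun n => 1 - (2 * y) ^+ n) (fun=> 1)).
  - apply: nearW => n; have /andP[a b] := yn n.
    rewrite exprn_ile1 ?subr_ge0 ?lerBlDr ?lerDl// andbT.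
    by rewrite -lerBlDr exprMn -natrX bernoulli_ineq.
  - rewrite -[X in _ --> X]subr0; apply: cvgB; first exact: cvg_cst.
    apply: cvg_expr; rewrite ger0_norm; last by rewrite mulr_ge0// ltW.
    by rewrite mulrC -ltr_pdivlMr// mul1r.
  - exact: cvg_cst.
have {}ygt : 2^-1 < y by rewrite lt_neqAle eq_sym y2.
have y20 : 0 < 2 * y by rewrite mulr_gt0.
(* From 1 - t <= e^(-t) the power is at most e^(-(2 y)^n), and e^u >= u turns this into (2
   y)^(-n). *)
apply: (@squeeze_cvgr _ _ _ _ (fun=> 0) (fun n => (2 * y)^-1 ^+ n)).
- apply: nearW => n; have /andP[a b] := yn n.
  rewrite exprn_ge0 ?subr_ge0//=.
  apply: (@le_trans _ _ (expR (- (y ^+ n)) ^+ (2 ^ n))).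
    by rewrite lerXn2r ?nnegrE ?subr_ge0 ?expR_ge0// expR_ge1Dx.
  rewrite -expRM_natl natrX mulrN -exprMn expRN exprVn.
  rewrite lef_pV2 ?posrE ?expR_gt0 ?exprn_gt0//.
  by rewrite (le_trans _ (expR_ge1Dx _))// lerDr.
- exact: cvg_cst.
- apply: cvg_expr; rewrite ger0_norm ?invr_ge0 ?(ltW y20)//.
  by rewrite invf_lt1// mulrC -ltr_pdivrMr// mul1r.
Qed.

Lemma poly_multiplier_ray (a : R) : poly_multiplier (\1_(`]a, +oo[)).
Proof.
have mi : measurable_fun setT (\1_(`]a, +oo[ : set R) : R -> R)
  by exact: measurable_indic.
have [a0|a0] := leP a 0.
  apply: (@poly_multiplier_cvg (fun _ _ => 1) _ 1 0) => //.
  - by move=> n; exact: poly_multiplier_cst.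
  - by move=> x _ _; rewrite normr1.
  - by move=> x _; rewrite indicE ger0_norm// lern1 leq_b1.
  - move=> x x0 _; rewrite indicE mem_set/=; first exact: cvg_cst.
    by rewrite in_itv/= andbT (le_lt_trans a0).
(* Chosen so that e^(-s a) = 1/2: the threshold y = 1/2 then corresponds to x = a. *)
pose s := ln 2 / a; have s0 : 0 < s by rewrite divr_gt0// ln_gt0// ltr1n.
apply: (@poly_multiplier_cvg (fun n x => (1 - expR (- (s * x)) ^+ n) ^+ (2 ^ n)) _ 1 a)
  => //.
- move=> n; apply: poly_multiplierX.
  under eq_fun do rewrite -mulN1r.
  apply: poly_multiplierD; first exact: poly_multiplier_cst.
  by apply/poly_multiplierZ/poly_multiplierX/poly_multiplier_exp; exact: ltW.
- move=> x x0 n.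
  have yn : 0 <= expR (- (s * x)) ^+ n <= 1.
    by rewrite exprn_ge0 ?expR_ge0//= exprn_ile1 ?expR_ge0// expR_le1 oppr_le0
      mulr_ge0// ltW.
  have /andP[h1 h2] := yn.
  by rewrite ger0_norm ?exprn_ge0 ?subr_ge0// exprn_ile1 ?subr_ge0 ?lerBlDr ?lerDl.
- by move=> x _; rewrite indicE ger0_norm// lern1 leq_b1.
- move=> x x0 xa.
  have E : (2^-1 : R) = expR (- (s * a)).
    by rewrite /s mulfVK ?gt_eqF// expRN lnK// posrE.
  rewrite indicE (_ : (x \in _) = (expR (- (s * x)) < 2^-1)); last first.
    rewrite E ltr_expR ltrN2 ltr_pM2l//.
    by apply/idP/idP => [/set_mem|H]; [|apply/mem_set]; rewrite /= in_itv/= andbT.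
  apply: cvg_pow_step.
    by rewrite expR_gt0 expR_le1 oppr_le0 mulr_ge0// ltW.
  rewrite E; apply/eqP => /expR_inj/oppr_inj/(mulfI (lt0r_neq0 s0)).
  exact/eqP.
Qed.

Lemma sum_indic_trivIset (F : nat -> set R) k x n : trivIset setT F -> F k x ->
  \sum_(i < n) \1_(F i) x = (k < n)%N%:R :> R.
Proof.
move=> /trivIsetP tF Fkx; elim: n => [|n IH]; first by rewrite big_ord0.
rewrite big_ord_recr/= IH indicE.
have [->|nk] := eqVneq n k; first by rewrite ltnn ltnSn mem_set// add0r.
rewrite memNset ?addr0 => [|Fnx]; last first.
  by have := tF n k I I nk; apply/eqP/set0P; exists x.
by rewrite ltnS (leq_eqVlt k) eq_sym (negbTE nk).
Qed.

(** Dynkin's theorem from the rays, which are stable under intersection. Disjointness keeps the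
    partial sums of a countable union bounded by 1, as bounded pointwise limits require. *)
Lemma poly_multiplier_indic (A : set R) : measurable A -> poly_multiplier (\1_A).
Proof.
move=> mA.
apply: (@dynkin_induction _ (measurableTypeR R) (@RGenOInfty.G R)
  (fun A : set R => poly_multiplier (\1_A))).
- exact: RGenOInfty.measurableE.
- move=> _ _ [x ->] [y ->]; exists (Num.max x y).
  by apply/seteqP; split => z /=; rewrite !in_itv/= !andbT gt_max => /andP.
- rewrite indicT; exact: poly_multiplier_cst.
- by move=> _ [x ->]; exact: poly_multiplier_ray.
- move=> S mS HS; rewrite indicC.
  have := poly_multiplierD (poly_multiplier_cst 1) (poly_multiplierZ (-1) HS).
  congr poly_multiplier; apply/funext => x; rewrite indicE.
  by case: (x \in S); rewrite /= ?mulr1 ?mulr0 ?subrr ?addr0.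
- move=> F mF tF HF.
  apply: (@poly_multiplier_cvg (fun n x => \sum_(i < n) \1_(F i) x) _ 1 0).
  + elim=> [|n IH].
      by under eq_fun do rewrite big_ord0; exact: poly_multiplier_cst.
    by under eq_fun do rewrite big_ord_recr/=; exact: poly_multiplierD.
  + by apply: measurable_indic; exact: bigcupT_measurable.
  + move=> x _ n; have [[k Fkx]|nF] := pselect (exists k, F k x).
      by rewrite (sum_indic_trivIset _ tF Fkx) ger0_norm// lern1 leq_b1.
    rewrite big1 ?normr0// => i _; rewrite indicE memNset// => Fix.
    by apply: nF; exists i.
  + by move=> x _; rewrite indicE ger0_norm// lern1 leq_b1.
  + move=> x _ _; have [[k Fkx]|nF] := pselect (exists k, F k x).
      under eq_fun do rewrite (sum_indic_trivIset _ tF Fkx).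
      rewrite indicE mem_set; last by exists k.
      by apply: cvg_near_cst; exists k.+1 => // n /= ->.
    rewrite indicE memNset => [|[i _ Fix]]; last by apply: nF; exists i.
    apply: cvg_near_cst; apply: nearW => n.
    rewrite big1// => i _; rewrite indicE memNset// => Fix.
    by apply: nF; exists i.
- have : (@RGenOInfty.G R).-sigma.-measurable A by rewrite -RGenOInfty.measurableE.
  by [].
Qed.

Import HBNNSimple.

Lemma poly_multiplier_nnsfun (h : {nnsfun (measurableTypeR R) >-> R}) :
  poly_multiplier h.
Proof.
have mh r : measurable (h @^-1` [set r] : set (measurableTypeR R)) by [].
have H (r : seq R) : poly_multiplier (fun x => \sum_(y <- r) y * \1_(h @^-1` [set y]) x).
  elim: r => [|y r IH].
    by under eq_fun do rewrite big_nil; exact: poly_multiplier_cst.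
  under eq_fun do rewrite big_cons.
  by apply: poly_multiplierD => //; apply: poly_multiplierZ;
    exact: (poly_multiplier_indic (mh y)).
rewrite (_ : (h : R -> R) = fun x =>
    \sum_(y <- finmap.enum_fset (fset_set (range h))) y * \1_(h @^-1` [set y]) x)//.
by apply/funext => x; rewrite fimfunE fsbig_finite.
Qed.

Lemma poly_closure_ge0 f : f \in L2 -> (forall x, 0 <= f x) -> poly_closure f.
Proof.
move=> fL f0; have mf := Lfun2_measurable fL.
have mE : measurable_fun (setT : set (measurableTypeR R)) (EFin \o f).
  exact/measurable_EFinP.
pose h := nnsfun_approx measurableT mE.
have hf x : (h n x)%:E @[n --> \oo] --> (f x)%:E.
  by apply: cvg_nnsfun_approx => // t _; rewrite lee_fin.
apply: (@poly_closure_dominated (fun n => h n) f f 0) => //.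
- move=> n; have [_ _ /(_ 1)] := poly_multiplier_nnsfun (h n); congr poly_closure.
  by apply/funext => x; rewrite hornerC mul1r.
- by move=> x _ _; exact: (fine_cvg (hf x)).
- move=> x _ n; rewrite !ger0_norm//.
  have cx : h i x @[i --> \oo] --> f x by exact: (fine_cvg (hf x)).
  rewrite -(cvg_lim _ cx)//; apply: (@nondecreasing_cvgn_le _ (fun i => h i x)).
    by move=> i j ij; have /lefP := nd_nnsfun_approx measurableT mE ij; apply.
  by apply/cvg_ex; exists (f x).
Qed.

Lemma poly_closure_L2 f : f \in L2 -> poly_closure f.
Proof.
move=> fL; have mf := Lfun2_measurable fL.
have pL : (fun x => Num.max (f x) 0) \in L2.
  apply: (@Lfun2_dom _ (measurableTypeR R) R nu _ f) => //.
    exact: measurable_maxr.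
  apply: (@ae_nu_gamma 0) => x _ _.
  by case: (leP (f x) 0) => f0; rewrite ?normr0 ?normr_ge0.
have nL : (fun x => Num.max (- f x) 0) \in L2.
  apply: (@Lfun2_dom _ (measurableTypeR R) R nu _ f) => //.
    by apply: measurable_maxr => //; exact: measurableT_comp.
  apply: (@ae_nu_gamma 0) => x _ _.
  by case: (leP (- f x) 0) => f0; rewrite ?normr0 ?normr_ge0// normrN.
have := poly_closureD (poly_closure_ge0 pL _)
  (poly_closureZ (-1) (poly_closure_ge0 nL _)).
have -> : (fun x => Num.max (f x) 0 + -1 * Num.max (- f x) 0) = f.
  apply/funext => x; case: (leP (f x) 0) => f0; case: (leP (- f x) 0) => f1; lra.
by apply=> x; rewrite le_max lexx orbT.
Qed.

End polynomial_density.

(** * Spectral decomposition of the Laguerre operator *)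

Section laguerre_basis.
Context {R : realType}.
Variables (gam : R) (gam_gt0 : 0 < gam).
Local Notation nu := (nu_gamma gam).
Local Notation L2 := (Lfun (nu_gamma gam) 2%:E).
Local Notation dot := (L2dot (nu_gamma gam)).
Implicit Types (f g : R -> R) (p q : {poly R}).

Lemma L2dot_horner p q : dot (horner p) (horner q) = moment gam (p * q).
Proof.
have -> : dot (horner p) (horner q) =
    dot (fun x => \sum_(i < size (p * q)) (p * q)`_i * x ^+ i) (horner 1).
  by apply: eq_Rintegral => x _; rewrite hornerC mulr1 -horner_coef hornerM.
have XL i : (fun x : R => x ^+ i) \in L2.
  rewrite (_ : (fun x => _) = horner 'X^i); first exact: horner_L2.
  by apply/funext => x; rewrite hornerXn.
rewrite (@L2dot_suml _ (measurableTypeR R) R nu _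
  (fun i x => (p * q)`_i * x ^+ i))//; last 2 first.
- by move=> i; exact: Lfun2Z.
- exact: horner_L2.
apply: eq_bigr => i _; rewrite L2dotZl//; last exact: horner_L2.
congr (_ * _); rewrite /L2dot /Rintegral -[RHS]/(fine (poch gam i)%:E).
rewrite -(integral_pow_nu_gamma gam_gt0); congr fine.
by apply: eq_integral => x _; rewrite hornerC mulr1.
Qed.

Definition elag n : {poly R} := (Num.sqrt (lag_norm2 gam n))^-1 *: lag gam n.

Lemma elag_L2 n : horner (elag n) \in L2.
Proof. exact: horner_L2. Qed.

Lemma L2dot_elag m n : dot (horner (elag m)) (horner (elag n)) = (m == n)%:R.
Proof.
have gt0 k : 0 < lag_norm2 gam k by exact: lag_norm2_gt0.
rewrite L2dot_horner /elag -scalerAl -scalerAr !linearZ/= moment_lagM//.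
case: eqP => [->|_]; last by rewrite mulr0n !mulr0.
rewrite mulr1n mulrA -invfM -expr2 sqr_sqrtr ?ltW// mulVf//.
by rewrite gt_eqF.
Qed.

(** A polynomial close to f lies in the span of the first n functions for every n >= [size p], so
    one approximation controls all later partial sums. *)
Lemma elag_basis f : f \in L2 ->
  L2cvg nu (L2_series nu (fun=> 1) (fun n => horner (elag n)) f) f.
Proof.
move=> fL.
apply: (@L2_basis_series _ (measurableTypeR R) R nu _ elag_L2 L2dot_elag) => // r r0.
have [_ /(_ r r0) [p fp]] := poly_closure_L2 gam_gt0 fL.
exists (size p) => n pn; have [c pE] := lag_span gam_gt0 pn.
(* The square roots undo the normalisation of [elag]. *)
exists (fun i => c i * Num.sqrt (lag_norm2 gam i)).
rewrite (_ : (fun x => _) = (fun x => f x - p.[x]))//.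
apply/funext => x; congr (_ - _); rewrite [in RHS]pE horner_sum.
apply: eq_bigr => i _; rewrite /elag !hornerZ mulrA mulfK//.
by rewrite gt_eqF// sqrtr_gt0 lag_norm2_gt0.
Qed.

Lemma Lpoly_is_linear : linear (Lpoly gam).
Proof.
by move=> a p q; rewrite /Lpoly !derivD !derivZ !mulrDr -!scalerAr scalerDr addrACA.
Qed.

HB.instance Definition _ := GRing.isLinear.Build R {poly R} {poly R} *:%R
  (Lpoly gam) Lpoly_is_linear.

Lemma Lpoly_elag n : Lpoly gam (elag n) = - n%:R *: elag n.
Proof. by rewrite /elag linearZ/= Lpoly_lag// !scalerA mulrC. Qed.

Lemma laguerre_horner p : laguerre gam (horner p) = horner (Lpoly gam p).
Proof.
apply/funext => x; rewrite /laguerre /Lpoly hornerD !hornerM hornerD hornerN hornerX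
  hornerC.
by rewrite !derivE.
Qed.

(** The closure from polynomials has exactly the maximal domain. One way, symmetry moves the
    operator onto e_n and the coefficients pass to the L^2 limit. Conversely, the partial sums of f
    are polynomials, and their images are the negated partial sums of the series for g. *)
Lemma laguerre_op_series f g : f \in L2 -> g \in L2 ->
  opp_graph (laguerre_op gam) f g <->
  L2cvg nu (L2_series nu (fun n => n%:R) (fun n => horner (elag n)) f) g.
Proof.
move=> fL gL; split.
  move=> [_ ngL [p [pf Lpg]]].
  apply: (@L2_series_coef _ (measurableTypeR R) R nu _ elag_basis (fun n => n%:R) f g
    gL) => n.
  have LpL k : laguerre gam (horner (p k)) \in L2.
    by rewrite laguerre_horner; exact: horner_L2.
  have pL k : horner (p k) \in L2 by exact: horner_L2.
  have H1 := L2cvg_dot LpL ngL (elag_L2 n) Lpg.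
  have H2 := L2cvg_dot pL fL (elag_L2 n) pf.
  have E k : dot (laguerre gam (horner (p k))) (horner (elag n)) =
      - n%:R * dot (horner (p k)) (horner (elag n)).
    rewrite laguerre_horner !L2dot_horner moment_Lpoly_sym Lpoly_elag.
    by rewrite -scalerAr linearZ.
  have H3 : - n%:R * dot (horner (p k)) (horner (elag n)) @[k --> \oo] -->
      - n%:R * dot f (horner (elag n)) by apply: cvgMr.
  move: H1; under eq_fun do rewrite E.
  move=> /(cvg_unique _ H3) => /(_ (@Rhausdorff R)).
  rewrite (L2dotNl gL (elag_L2 n)) mulNr => /oppr_inj ->//.
move=> H.
pose p n : {poly R} := \sum_(i < n) dot f (horner (elag i)) *: elag i.
split => //; first exact: Lfun2N.
exists p; split.
  apply: eq_L2cvg (elag_basis fL) => n x.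
  rewrite /p horner_sum; apply: eq_bigr => i _.
  by rewrite [RHS]hornerZ mul1r.
have SL n : L2_series nu (fun n => n%:R) (fun n => horner (elag n)) f n \in L2.
  exact: (L2_series_Lfun elag_L2).
apply: eq_L2cvg (L2cvgN SL gL H) => n x.
have LE i a : Lpoly gam (a *: elag i) = (- i%:R * a) *: elag i.
  by rewrite linearZ/= Lpoly_elag scalerA mulrC.
rewrite laguerre_horner /p [Lpoly _ _]linear_sum horner_sum -sumrN; apply: eq_bigr => i _.
by rewrite [X in _ = X.[x]]LE [RHS]hornerZ; ring.
Qed.

Lemma laguerre_diagonalizes : diagonalizes nu (opp_graph (laguerre_op gam))
  (fun n => n%:R) (fun n => horner (elag n)).
Proof.
split; [exact: elag_L2|exact: L2dot_elag|exact: elag_basis|exact: laguerre_op_series].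
Qed.

End laguerre_basis.

(** * The gateway relation on the eigenbases *)

Section gateway.
Context {R : realType}.
Local Notation leb := (@lebesgue_measure R).
Variables (beta eps : R) (beta_gt0 : 0 < beta) (eps_gt0 : 0 < eps).

Let be_gt0 : 0 < beta + eps. Proof. exact: addr_gt0. Qed.

(** The factor e^(-u s) merges with e^(-eps s), which leaves the exponential form of the Beta
    integral at (u + eps, beta). *)
Lemma F_tauE u : 0 <= u -> F_tau beta eps u =
  Gamma (beta + eps) * Gamma (u + eps) / (Gamma eps * Gamma (u + beta + eps)).
Proof.
move=> u0; have ue0 : 0 < u + eps by rewrite ltr_wpDl.
have mh : measurable_fun setT
    (fun s : R => (expR (- ((u + eps) * s)) * (1 - expR (- s)) `^ (beta - 1))%:E).
  apply/measurable_EFinP; apply: measurable_funM.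
    apply: measurableT_comp; first exact: measurable_expR.
    by apply: measurableT_comp => //; exact: measurable_funM.
  apply: (measurableT_comp (measurable_powR _)); apply: measurable_funB => //.
  by apply: measurableT_comp => //; exact: measurable_expR.
rewrite /F_tau /Rintegral integral_mkcond.
have mexp : measurable_fun setT
    ((fun s : R => (expR (- (u * s)))%:E) \_ `[0, +oo[).
  apply/(measurable_restrictT _ _).1 => //; apply/measurable_EFinP.
  apply: measurable_funTS; apply: measurableT_comp; first exact: measurable_expR.
  by apply: measurableT_comp => //; exact: measurable_funM.
rewrite (@ge0_integral_density _ (measurableTypeR R) R leb (tau_law beta eps)
  (tau_pdf beta eps)
  (tau_pdf_ge0 beta eps) (measurable_tau_pdf beta eps) (fun A _ => erefl))//; last first.
  by move=> s; rewrite patchE; case: ifP => // _; rewrite lee_fin expR_ge0.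
rewrite [X in fine X](_ : _ = (beta_cst beta eps)%:E * EBeta (u + eps) beta)%E.
  rewrite EBetaE//= /beta_cst (_ : u + eps + beta = u + beta + eps); last by ring.
  have := lt0r_neq0 (Gamma_gt0 beta_gt0); have := lt0r_neq0 (Gamma_gt0 eps_gt0).
  have := lt0r_neq0 (Gamma_gt0 (ltr_wpDl (addr_ge0 u0 (ltW beta_gt0)) eps_gt0)).
  move: (Gamma _) (Gamma _) (Gamma _) (Gamma _) (Gamma _) => G1 G2 G3 G4 G5 G10 G20 G30.
  by field; rewrite ?G10 ?G20 ?G30.
rewrite EBeta_expR -ge0_integralZl//; last 3 first.
- exact: measurable_funTS.
- by move=> x _; rewrite lee_fin mulr_ge0 ?expR_ge0 ?powR_ge0.
- by rewrite lee_fin divr_ge0 ?mulr_ge0 ?Gamma_ge0.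
rewrite integral_itv_obnd_cbnd; last first.
  by apply: measurable_funTS; apply: emeasurable_funM.
rewrite [RHS]integral_mkcond; apply: eq_integral => s _; rewrite !patchE /tau_pdf patchE.
case: ifPn => _; last by rewrite mul0e.
rewrite -!EFinM; congr EFin; rewrite mulrCA; congr (_ * _).
by rewrite mulrA -expRD; congr (expR _ * _); ring.
Qed.

Lemma Rintegral_sum d (T : measurableType d) (m : {measure set T -> \bar R}) n
    (F : nat -> T -> R) : (forall i, m.-integrable setT (EFin \o F i)) ->
  \int[m]_x (\sum_(i < n) F i x) = \sum_(i < n) \int[m]_x F i x.
Proof.
move=> iF; elim: n => [|n IH].
  rewrite big_ord0 /Rintegral integral0_eq// => x _.
  by rewrite big_ord0.
rewrite big_ord_recr/= -IH -RintegralD//.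
  by apply: eq_Rintegral => x _; rewrite big_ord_recr.
have := @integrable_sum _ _ _ m setT measurableT _ (index_enum 'I_n) xpredT
  (fun i => EFin \o F i) (fun i _ => iF i).
by apply: eq_integrable => // x _; rewrite /= sumEFin.
Qed.

(** The power r^i shifts the first Beta parameter from eps to eps + i; the ratio of the two Beta
    values is the quotient of rising factorials. *)
Lemma Lambda_horner (p : {poly R}) N z : (size p <= N)%N ->
  Lambda beta eps (horner p) z =
  \sum_(i < N) p`_i * z ^+ i * (poch eps i / poch (beta + eps) i).
Proof.
move=> pN; rewrite LambdaE.
pose F (i : nat) r := p`_i * z ^+ i * (pos_pow (eps + i%:R) r * pos_pow beta (1 - r)).
have ei i : 0 < eps + i%:R by rewrite ltr_pwDl.
have ibw i : leb.-integrable setT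
    (EFin \o (fun r => pos_pow (eps + i%:R) r * pos_pow beta (1 - r))).
  apply/integrableP; split; first by apply/measurable_EFinP; exact: measurable_beta_w.
  under eq_integral do rewrite gee0_abs ?lee_fin ?mulr_ge0 ?pos_pow_ge0//.
  by rewrite -/(EBeta _ _) EBetaE ?ltry.
transitivity (beta_cst beta eps * \int[leb]_r (\sum_(i < N) F i r)).
  congr (_ * _); apply: eq_Rintegral => r _; rewrite (horner_coef_wide _ pN) mulr_suml.
  by apply: eq_bigr => i _; rewrite /F -pos_pow_mulXn exprMn; ring.
rewrite Rintegral_sum; last first.
  move=> i; have := integrableZl measurableT (p`_i * z ^+ i) (ibw i).
  by apply: eq_integrable => // x _; rewrite /= EFinM.
rewrite mulr_sumr; apply: eq_bigr => i _.
rewrite /F RintegralZl// mulrCA; congr (_ * _).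
rewrite /Rintegral -/(EBeta _ _) EBetaE//= /beta_cst.
rewrite (_ : eps + i%:R + beta = beta + eps + i%:R); last by ring.
rewrite !Gamma_addn//.
have := lt0r_neq0 (Gamma_gt0 beta_gt0); have := lt0r_neq0 (Gamma_gt0 eps_gt0).
have := lt0r_neq0 (Gamma_gt0 be_gt0); have := lt0r_neq0 (poch_gt0 i be_gt0).
move: (Gamma _) (Gamma _) (Gamma _) (poch _ _) (poch _ _) => G1 G2 G3 p1 p2 h1 h2 h3 h4.
by field; rewrite ?h1 ?h2 ?h3 ?h4.
Qed.

Definition gateway_cst n : R :=
  Num.sqrt (lag_norm2 (beta + eps) n) / Num.sqrt (lag_norm2 eps n).

Lemma gateway_cst_sqr n : gateway_cst n * gateway_cst n = F_tau beta eps n%:R.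
Proof.
have l1 := lag_norm2_gt0 n eps_gt0; have l2 := lag_norm2_gt0 n be_gt0.
rewrite /gateway_cst mulrACA -invfM -!expr2 !sqr_sqrtr ?ltW// F_tauE//.
rewrite (_ : n%:R + beta + eps = beta + eps + n%:R); last by ring.
rewrite (addrC n%:R) !Gamma_addn// /lag_norm2.
have := lt0r_neq0 (Gamma_gt0 eps_gt0); have := lt0r_neq0 (Gamma_gt0 be_gt0).
have := lt0r_neq0 (poch_gt0 n be_gt0); have := lt0r_neq0 (poch_gt0 n eps_gt0).
have : n`!%:R != 0 :> R by rewrite pnatr_eq0 -lt0n fact_gt0.
move: (Gamma _) (Gamma _) (poch _ _) (poch _ _) (n`!%:R) => G1 G2 p1 p2 nf h1 h2 h3 h4 h5.
by field; rewrite ?h1 ?h2 ?h3 ?h4 ?h5.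
Qed.

Lemma Lambda_elag n : Lambda beta eps (horner (elag eps n)) =
  (fun z => gateway_cst n * (elag (beta + eps) n).[z]).
Proof.
apply/funext => z; rewrite (@Lambda_horner _ n.+1); last first.
  by rewrite (leq_trans (size_scale_leq _ _))// size_lag_leq.
rewrite /elag hornerZ (horner_coef_wide _ (size_lag_leq _ _)) !mulr_sumr.
apply: eq_bigr => i _; rewrite coefZ !coef_lag /gateway_cst.
have := lt0r_neq0 (poch_gt0 i be_gt0); have := lt0r_neq0 (poch_gt0 i eps_gt0).
have : Num.sqrt (lag_norm2 eps n) != 0 by rewrite gt_eqF// sqrtr_gt0 lag_norm2_gt0.
have : Num.sqrt (lag_norm2 (beta + eps) n) != 0.
  by rewrite gt_eqF// sqrtr_gt0 lag_norm2_gt0.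
move: (Num.sqrt _) (Num.sqrt _) (poch _ _) (poch _ _) => s1 s2 p1 p2 h1 h2 h3 h4.
by field; rewrite ?h1 ?h2 ?h3 ?h4.
Qed.

End gateway.

(** * Coefficients of the two products in the eigenbases *)

Section gateway_adjoint.
Context {R : realType}.
Variables (beta eps : R) (beta_gt0 : 0 < beta) (eps_gt0 : 0 < eps).
Let be_gt0 : 0 < beta + eps. Proof. exact: addr_gt0. Qed.

Lemma L2dot_Lambda_elag n (g : R -> R) : g \in Lfun (nu_gamma (beta + eps)) 2%:E ->
  L2dot (nu_gamma (beta + eps)) (Lambda beta eps (horner (elag eps n))) g =
  gateway_cst beta eps n * L2dot (nu_gamma (beta + eps)) g (horner (elag (beta + eps) n)).
Proof.
move=> gL; rewrite (Lambda_elag beta_gt0 eps_gt0).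
rewrite [X in _ = _ * X](@L2dotC _ (measurableTypeR R) R (nu_gamma (beta + eps)) g).
exact: (L2dotZl _ (elag_L2 be_gt0 n) gL).
Qed.

(** Lambda^* e'_n = c_n e_n in weak form: duality gives its coefficient c_m <e'_n, e'_m> on each
    e_m, which vanishes unless m = n. *)
Lemma Lambda_adj_elag n (h : R -> R) : h \in Lfun (nu_gamma eps) 2%:E ->
  L2dot (nu_gamma eps) h (Lambda_adj beta eps (horner (elag (beta + eps) n))) =
  gateway_cst beta eps n * L2dot (nu_gamma eps) h (horner (elag eps n)).
Proof.
move=> hL; have eL k := elag_L2 eps_gt0 k; have e'L k := elag_L2 be_gt0 k.
have [aL adjE] := Lambda_adjP beta_gt0 eps_gt0 (e'L n).
apply: (L2dot_eigenvector eL (elag_basis eps_gt0) hL aL) => m.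
rewrite -(adjE _ (eL m)) (L2dot_Lambda_elag m (e'L n)) (L2dot_elag be_gt0) eq_sym.
by case: eqP => [->|_]; rewrite ?mulr0.
Qed.

(** With L for [Lambda]: <L L^* f, e'_n> = <L^* f, L^* e'_n> = c_n <L^* f, e_n> = c_n <f, L e_n> =
    c_n^2 <f, e'_n>. *)
Lemma L2dot_Lambda_Lambda_adj n (f : R -> R) :
  f \in Lfun (nu_gamma (beta + eps)) 2%:E ->
  L2dot (nu_gamma (beta + eps)) (Lambda beta eps (Lambda_adj beta eps f))
    (horner (elag (beta + eps) n)) =
  F_tau beta eps n%:R * L2dot (nu_gamma (beta + eps)) f (horner (elag (beta + eps) n)).
Proof.
move=> fL; have [hL fE] := Lambda_adjP beta_gt0 eps_gt0 fL.
have [_ adjE] := Lambda_adjP beta_gt0 eps_gt0 (elag_L2 be_gt0 n).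
rewrite (adjE _ hL) (Lambda_adj_elag n hL) L2dotC -(fE _ (elag_L2 eps_gt0 n)).
by rewrite (L2dot_Lambda_elag n fL) mulrA (gateway_cst_sqr beta_gt0 eps_gt0).
Qed.

(** With L for [Lambda]: <L^* L f, e_n> = <L f, L e_n> = c_n <L f, e'_n> = c_n <f, L^* e'_n> = c_n^2
    <f, e_n>. *)
Lemma L2dot_Lambda_adj_Lambda n (f : R -> R) : f \in Lfun (nu_gamma eps) 2%:E ->
  L2dot (nu_gamma eps) (Lambda_adj beta eps (Lambda beta eps f))
    (horner (elag eps n)) =
  F_tau beta eps n%:R * L2dot (nu_gamma eps) f (horner (elag eps n)).
Proof.
move=> fL; have LfL := Lambda_L2 beta_gt0 eps_gt0 fL.
have [_ fE] := Lambda_adjP beta_gt0 eps_gt0 LfL.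
have [_ adjE] := Lambda_adjP beta_gt0 eps_gt0 (elag_L2 be_gt0 n).
rewrite L2dotC -(fE _ (elag_L2 eps_gt0 n)) (L2dot_Lambda_elag n LfL) (adjE _ fL).
by rewrite (Lambda_adj_elag n fL) mulrA (gateway_cst_sqr beta_gt0 eps_gt0).
Qed.

End gateway_adjoint.

Local Close Scope classical_set_scope.

Theorem proposition21 (R : realType) (beta eps : R)
    (beta_gt0 : 0 < beta) (eps_gt0 : 0 < eps) :
  [/\ is_functional_calculus (nu_gamma (beta + eps))
        (opp_graph (laguerre_op (beta + eps))) (F_tau beta eps)
        (Lambda beta eps \o Lambda_adj beta eps),
      forall u : R, 0 <= u ->
        F_tau beta eps u = Gamma (beta + eps) * Gamma (u + eps) /
                           (Gamma eps * Gamma (u + beta + eps))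
    & is_functional_calculus (nu_gamma eps)
        (opp_graph (laguerre_op eps)) (F_tau beta eps)
        (Lambda_adj beta eps \o Lambda beta eps)].
Proof.
have be_gt0 : 0 < beta + eps by exact: addr_gt0.
split; last 2 first.
- by move=> u; exact: (F_tauE beta_gt0 eps_gt0).
- exists (fun n => n%:R), (fun n => horner (elag eps n)).
  split=> [|f fL]; first exact: (laguerre_diagonalizes eps_gt0).
  have [SL _] := Lambda_adjP beta_gt0 eps_gt0 (Lambda_L2 beta_gt0 eps_gt0 fL).
  split; first exact: SL.
  exact: (@L2_series_coef _ (measurableTypeR R) R _ _ (elag_basis eps_gt0)
    (F_tau beta eps \o (fun n => n%:R)) f _ SL
    (fun n => L2dot_Lambda_adj_Lambda beta_gt0 eps_gt0 n fL)).
- exists (fun n => n%:R), (fun n => horner (elag (beta + eps) n)).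
  split=> [|f fL]; first exact: (laguerre_diagonalizes be_gt0).
  have [hL _] := Lambda_adjP beta_gt0 eps_gt0 fL.
  have SL := Lambda_L2 beta_gt0 eps_gt0 hL.
  split; first exact: SL.
  exact: (@L2_series_coef _ (measurableTypeR R) R _ _ (elag_basis be_gt0)
    (F_tau beta eps \o (fun n => n%:R)) f _ SL
    (fun n => L2dot_Lambda_Lambda_adj beta_gt0 eps_gt0 n fL)).
Qed.
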